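(* Suppose Assumption 1 (path realization) and Assumption 2 (additivity along the core, $\mathcal H_\kappa=\mathcal A(\gamma)$) hold. Then, for every $h=h_\kappa+h_\perp\in\mathcal T$ with $h_\kappa\in\mathcal H_\kappa$ and $h_\perp\in\mathcal H_\kappa^\perp\cap\mathcal T$, $$\gamma(h)=\langle\tilde\psi_\kappa,h_\kappa\rangle+\gamma(h_\perp),$$ and the Gaussian-shift limit experiment indexed by $h\in\mathcal T$ is the independent product of the experiments indexed by $h_\kappa\in\mathcal H_\kappa$ and by $h_\perp\in\mathcal H_\kappa^\perp\cap\mathcal T$. The target $\gamma$ is a linear functional of the first coordinate $h_\kappa$ (with representer $\tilde\psi_\kappa$ and bound $V_\kappa=\|\tilde\psi_\kappa\|^2$) plus $\gamma|_{\mathcal H_\kappa^\perp\cap\mathcal T}$ evaluated at $h_\perp$, and the core of $\gamma|_{\mathcal H_\kappa^\perp\cap\mathcal T}$ is $\{0\}$.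
   Context: Model. $P$ is a fixed element of a set $\mathcal P$ of probability measures; $L_2^0(P)$ is the mean-zero subspace of $L_2(P)$ with inner product $\langle\cdot,\cdot\rangle$. A DQM path with score $h$ is a map $t\mapsto P_t\in\mathcal P$, $t\in[0,\varepsilon)$, $P_0=P$, with $\int[(dP_t^{1/2}-dP^{1/2})/t-\tfrac12h\,dP^{1/2}]^2\to0$ as $t\downarrow0$. The tangent space $\mathcal T\subseteq L_2^0(P)$ is a linear subspace. Assumption 1: $\mathcal T$ is closed in $L_2(P)$ and every $h\in\mathcal T$ is the score of some DQM path in $\mathcal P$. $\gamma:\mathcal T\to\mathbb R$ is the positively homogeneous directional derivative of $\Psi:\mathcal P\to\mathbb R$ at $P$: $t^{-1}\{\Psi(P_t)-\Psi(P)\}\to\gamma(h)$ as $t\downarrow0$ for every $h\in\mathcal T$ and every DQM path with score $h$; $\gamma$ is then continuous. For a continuous positively homogeneous $g$ on a Hilbert space $E$, put $N(g):=\{h\in E:g(h)+g(-h)=0\}$; its core is $\{w\in N(g):g(v+cw)=g(v)+cg(w)\ \forall v\in N(g),c\in\mathbb R\}$; its additivity space is $\mathcal A(g):=\{w\in E:g(h+w)=g(h)+g(w)\ \forall h\in E\}$. $\mathcal H_\kappa$ is the core of $\gamma$ (on $E=\mathcal T$), a closed linear subspace on which $\gamma$ is linear, and $\tilde\psi_\kappa\in\mathcal H_\kappa$ is the Riesz representer of $\gamma|_{\mathcal H_\kappa}$. The Gaussian-shift experiment indexed by $h$ in a closed subspace $E\subseteq\mathcal T$ is: under $h$ one observes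 the process $\Delta+\langle h,\cdot\rangle$ on $E$, where $\Delta$ is isonormal on $E$ (centred Gaussian, $\operatorname{Cov}(\Delta(g),\Delta(g'))=\langle g,g'\rangle$). *)

(* Defs.v *)
From HB Require Import structures.
From mathcomp Require Import all_boot all_order all_algebra.
From mathcomp Require Import all_classical all_reals all_analysis.
From mathcomp Require Import measurable_realfun ess_sup_inf.

Set Implicit Arguments.
Unset Strict Implicit.
Unset Printing Implicit Defensive.

Import Order.TTheory GRing.Theory Num.Theory.
Import numFieldNormedType.Exports.

Local Open Scope classical_set_scope.
Local Open Scope ring_scope.
Local Open Scope quotient_scope.

(* The library defines [LspaceType mu p1] as a quotient by a.e. equality but
   gives it no algebraic structure; the vector space structure induced by
   [LfunType mu p1] is set up here. *)
Section LspaceLmodule.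
Context d (X : measurableType d) (R : realType).
Variables (mu : {measure set X -> \bar R}) (p : \bar R) (p1 : (1 <= p)%E).

Local Notation Lp := (LspaceType mu p1).
Local Notation LF := (LfunType mu p1).

HB.instance Definition _ := gen_eqMixin Lp.
HB.instance Definition _ := gen_choiceMixin Lp.

Lemma Lspace_repr_Lfun (u : Lp) : (u : X -> R) \in Lfun mu p.
Proof.
rewrite inE; apply/andP; split.
  by rewrite inE /=; exact: (measurable_funPT (repr (u : aeEqMfun _ mu))).
by rewrite inE /=; exact: Lebesgue_finite.
Qed.

Definition Lspace_repr (u : Lp) : LF := Lfun_Sub p1 (Lspace_repr_Lfun u).


Lemma Lfun_mfunR (f : LF) : (f : X -> measurableTypeR R) \in mfun.
Proof. by rewrite inE /=; exact: (measurable_funPT (f : {mfun X >-> R})). Qed.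

(* [LspaceType] is built on [measurableTypeR R], whose measurable structure is
   convertible to, but displayed differently from, that of [R]. *)
Definition Lfun_toR (f : LF) : {mfun X >-> measurableTypeR R} :=
  mfun_Sub (Lfun_mfunR f).

Local Notation Q := {mfun_ mu, X >-> measurableTypeR R}.

Definition ae_class (f : LF) : Q := \pi_Q (Lfun_toR f).

Lemma ae_class_ae (f : LF) : (ae_class f : X -> R) = f %[ae mu].
Proof.
have /eqP := reprK (ae_class f).
by rewrite eqmodE => /asboolP.
Qed.

Lemma ae_eq_Lnorm (f g : X -> R) : measurable_fun setT f ->
  measurable_fun setT g -> f = g %[ae mu] ->
  Lnorm mu p (EFin \o f) = Lnorm mu p (EFin \o g).
Proof.
move=> mf mg fg; rewrite unlock /Lnorm; case: p p1 => [r|//|//] _.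
- have mpow (h : X -> R) : measurable_fun setT h ->
      measurable_fun [set: X] (fun x => (`|(EFin \o h) x| `^ r)%E).
    move=> mh; apply: (measurableT_comp (measurable_poweR r)).
    by apply: measurableT_comp => //; exact/measurable_EFinP.
  congr (_ `^ _)%E; apply: ge0_ae_eq_integral => //.
  + exact: mpow.
  + exact: mpow.
  + by move=> x _; exact: poweR_ge0.
  + by move=> x _; exact: poweR_ge0.
  + by apply: filterS fg => x /= /[apply] ->.
- case: ifPn => // _; apply: eq_ess_sup.
  by apply: filterS fg => x /= ->.
Qed.

Lemma ae_class_finite (f : LF) : finite_norm mu p (ae_class f).
Proof.
rewrite /finite_norm (@ae_eq_Lnorm _ f); first exact: Lfunction_finite.
- exact: (measurable_funPT (repr (ae_class f))).
- exact: (measurable_funPT (f : {mfun X >-> R})).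
- exact: ae_class_ae.
Qed.

HB.instance Definition _ (f : LF) :=
  isFinLebesgue.Build d X R mu p p1 (ae_class f) (ae_class_finite f).

Definition Lclass (f : LF) : Lp := ae_class f.

Lemma LclassE (f : LF) : (Lclass f : X -> R) = f %[ae mu].
Proof. exact: ae_class_ae. Qed.

Lemma Lspace_eqP (u v : Lp) : u = v <-> (u : X -> R) = v %[ae mu].
Proof.
split=> [-> |uv]; first exact: nearW.
have : (u : Q) = (v : Q).
  by apply/eqP; rewrite -(reprK (u : Q)) -(reprK (v : Q)) eqmodE; apply/asboolP.
case: u v {uv} => [u [[pu]]] [v [[pv]]] /= uv.
by subst v; congr LebesgueSpace.Pack; congr LebesgueSpace.Class;
   congr isFinLebesgue.Axioms_; exact: Prop_irrelevance.
Qed.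

Lemma Lspace_reprK : cancel Lspace_repr Lclass.
Proof. by move=> u; apply/Lspace_eqP; exact: LclassE. Qed.

Lemma LclassP (f g : LF) : Lclass f = Lclass g <-> (f : X -> R) = g %[ae mu].
Proof.
split=> [fg | fg].
  apply: ae_eq_trans (LclassE g); rewrite -fg.
  by apply: ae_eq_sym; exact: LclassE.
apply/Lspace_eqP; apply: ae_eq_trans (LclassE f) _.
by apply: ae_eq_trans fg _; apply: ae_eq_sym; exact: LclassE.
Qed.

Definition Ladd (u v : Lp) : Lp := Lclass (Lspace_repr u + Lspace_repr v).
Definition Lopp (u : Lp) : Lp := Lclass (- Lspace_repr u).
Definition Lscale (a : R) (u : Lp) : Lp := Lclass (a *: Lspace_repr u).

Lemma Lclass_add (f g : LF) : Lclass (f + g) = Ladd (Lclass f) (Lclass g).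
Proof.
apply/LclassP; apply: filterS2 (LclassE f) (LclassE g) => x fx gx _.
exact/esym/(congr2 +%R (fx I) (gx I)).
Qed.

Lemma Lclass_opp (f : LF) : Lclass (- f) = Lopp (Lclass f).
Proof.
apply/LclassP; apply: filterS (LclassE f) => x fx _.
exact/esym/(congr1 -%R (fx I)).
Qed.

Lemma Lclass_scale a (f : LF) : Lclass (a *: f) = Lscale a (Lclass f).
Proof.
apply/LclassP; apply: filterS (LclassE f) => x fx _.
exact/esym/(congr1 ( *%R a) (fx I)).
Qed.

Lemma LaddA : associative Ladd.
Proof.
move=> u v w; rewrite -(Lspace_reprK u) -(Lspace_reprK v) -(Lspace_reprK w).
by rewrite -!Lclass_add addrA.
Qed.

Lemma LaddC : commutative Ladd.
Proof. by move=> u v; rewrite /Ladd addrC. Qed.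

Lemma Ladd0 : left_id (Lclass 0) Ladd.
Proof. by move=> u; rewrite -(Lspace_reprK u) -Lclass_add add0r. Qed.

Lemma LaddN : left_inverse (Lclass 0) Lopp Ladd.
Proof. by move=> u; rewrite -(Lspace_reprK u) -Lclass_opp -Lclass_add addNr. Qed.

HB.instance Definition _ :=
  GRing.isZmodule.Build Lp LaddA LaddC Ladd0 LaddN.

Lemma LscaleA a b (u : Lp) : Lscale a (Lscale b u) = Lscale (a * b) u.
Proof. by rewrite -(Lspace_reprK u) -!Lclass_scale scalerA. Qed.

Lemma Lscale1 : left_id 1 Lscale.
Proof. by move=> u; rewrite -(Lspace_reprK u) -Lclass_scale scale1r. Qed.

Lemma LscaleDr : right_distributive Lscale +%R.
Proof.
move=> a u v; rewrite -(Lspace_reprK u) -(Lspace_reprK v).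
rewrite -[_ + _]Lclass_add -!Lclass_scale scalerDr; exact: Lclass_add.
Qed.

Lemma LscaleDl (u : Lp) : {morph Lscale^~ u : a b / a + b}.
Proof.
move=> a b /=; rewrite -(Lspace_reprK u) -!Lclass_scale scalerDl.
exact: Lclass_add.
Qed.

HB.instance Definition _ :=
  GRing.Zmodule_isLmodule.Build R Lp LscaleA Lscale1 LscaleDr LscaleDl.

Lemma Lspace_addE (u v : Lp) :
  ((u + v : Lp) : X -> R) = (fun x => u x + v x) %[ae mu].
Proof. exact: LclassE. Qed.

Lemma Lspace_oppE (u : Lp) : ((- u : Lp) : X -> R) = (fun x => - u x) %[ae mu].
Proof. exact: LclassE. Qed.

Lemma Lspace_scaleE a (u : Lp) :
  ((a *: u : Lp) : X -> R) = (fun x => a * u x) %[ae mu].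
Proof. exact: LclassE. Qed.

Lemma Lspace_zeroE : ((0 : Lp) : X -> R) = (fun=> 0) %[ae mu].
Proof. exact: LclassE. Qed.

End LspaceLmodule.

Section HilbertL2.
Context d (X : measurableType d) (R : realType) (P : probability X R).

Definition L2 : Type := LspaceType P (lee1n 2).
HB.instance Definition _ := GRing.Lmodule.on L2.

Definition inner (f g : L2) : R := \int[P]_x (f x * g x).

Definition L2norm (f : L2) : R := Num.sqrt (inner f f).

Definition L2_0 : set L2 := [set f : L2 | \int[P]_x (f x) = 0].

Definition linear_subspace (E : set L2) : Prop :=
  E 0 /\ forall (a : R) (u v : L2), E u -> E v -> E (a *: u + v).

Definition L2_closed (E : set L2) : Prop :=
  forall f, (forall e : R, 0 < e -> exists2 g, E g & L2norm (f - g) < e) -> E f.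

Definition orthocomplement (E : set L2) : set L2 :=
  [set f | forall w, E w -> inner f w = 0].

(* In the following definitions [g : L2 -> R] stands for a function on the
   subspace [E]; only its values on [E] matter. *)

Definition positively_homogeneous (E : set L2) (g : L2 -> R) : Prop :=
  forall (c : R) h, 0 <= c -> E h -> g (c *: h) = c * g h.

Definition antisymmetric_part (E : set L2) (g : L2 -> R) : set L2 :=
  [set h | E h /\ g h + g (- h) = 0].

Definition core (E : set L2) (g : L2 -> R) : set L2 :=
  [set w | antisymmetric_part E g w /\
    forall v (c : R), antisymmetric_part E g v -> g (v + c *: w) = g v + c * g w].

Definition additivity_space (E : set L2) (g : L2 -> R) : set L2 :=
  [set w | E w /\ forall h, E h -> g (h + w) = g h + g w].

Lemma core_sub (E : set L2) (g : L2 -> R) : core E g `<=` E.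
Proof. by move=> w [[]]. Qed.

Definition riesz_representer (E : set L2) (g : L2 -> R) (psi : L2) : Prop :=
  E psi /\ forall h, E h -> g h = inner psi h.

(* Supremum over one-dimensional submodels [t |-> t *: h], [h] in [E], of the
   Cramer-Rao bound [g(h)^2 / |h|^2] for a linear [g]. The direction [h = 0]
   contributes [0 / 0 = 0]. *)
Definition information_bound (E : set L2) (g : L2 -> R) : \bar R :=
  ereal_sup [set ((g h) ^+ 2 / (L2norm h) ^+ 2)%:E | h in E].

End HilbertL2.

Section Paths.
Local Open Scope charge_scope.
Context d (X : measurableType d) (R : realType).
Local Notation prob := (probability X R).

Definition dominating (P Q : prob) : set X -> \bar R := measure_add P Q.

HB.instance Definition _ (P Q : prob) := Measure.on (dominating P Q).

Lemma dominating_finite (P Q : prob) : fin_num_fun (dominating P Q).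
Proof.
by move=> A mA; rewrite /dominating measure_addE fin_numD !fin_num_measure.
Qed.

HB.instance Definition _ (P Q : prob) :=
  Measure_isFinite.Build _ _ _ (dominating P Q) (dominating_finite P Q).

Definition sqrt_density (mu : {sigma_finite_measure set X -> \bar R}) (Q : prob)
    (x : X) : R :=
  Num.sqrt (fine (('d (charge_of_finite_measure Q) '/d mu) x)).

(* The integral [int ((dQ^{1/2} - dP^{1/2}) / t - (1/2) h dP^{1/2})^2] does not
   depend on the dominating measure; it is evaluated with [P + Q]. *)
Definition dqm_remainder (P Q : prob) (h : L2 P) (t : R) : \bar R :=
  \int[dominating P Q]_x
    (((sqrt_density (dominating P Q) Q x - sqrt_density (dominating P Q) P x) / t
      - 2^-1 * h x * sqrt_density (dominating P Q) P x) ^+ 2)%:E.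

(* only the values of the path on some interval [0, e) matter *)
Definition dqm_path (PP : set prob) (P : prob) (h : L2 P) (Pt : R -> prob) : Prop :=
  [/\ exists2 e : R, 0 < e & (forall t : R, 0 <= t < e -> PP (Pt t)),
      Pt 0 = P
    & dqm_remainder (Pt t) h t @[t --> 0^'+] --> 0%E].

Definition path_realization (PP : set prob) (P : prob) (T : set (L2 P)) : Prop :=
  L2_closed T /\ forall h, T h -> exists Pt, dqm_path PP h Pt.

Definition directional_derivative (PP : set prob) (P : prob) (T : set (L2 P))
    (Psi : prob -> R) (gamma : L2 P -> R) : Prop :=
  positively_homogeneous T gamma /\
  forall h Pt, T h -> dqm_path PP h Pt ->
    t^-1 * (Psi (Pt t) - Psi P) @[t --> 0^'+] --> gamma h.

End Paths.

Section GaussianShift.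
Context d (X : measurableType d) (R : realType) (P : probability X R).

(* The library's [normal_prob m 0] is the uniform law on [0, 1], hence the
   separate treatment of the degenerate case. *)
Definition normal_law (m s : R) : set R -> \bar R :=
  if s == 0 then \d_m else normal_prob m s.

Definition isonormal (E : set (L2 P)) d' (Omega : measurableType d')
    (Q : probability Omega R) (Delta : E -> Omega -> R) : Prop :=
  [/\ forall g, measurable_fun setT (Delta g),
      forall n (a : 'I_n -> R) (g : 'I_n -> E), exists s : R,
        forall A, measurable A ->
          Q [set w | A (\sum_(i < n) a i * Delta (g i) w)] = normal_law 0 s A
    & forall g g' : E, covariance Q (Delta g) (Delta g') = (inner (val g) (val g'))%:E].

(* R^E with its product sigma-algebra *)
Definition cylinders (E : set (L2 P)) : set (set (E -> R)) :=
  \bigcup_(g in [set: E]) preimage_set_system setT (fun x : E -> R => x g) measurable.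

Definition paths (E : set (L2 P)) := g_sigma_algebraType (@cylinders E).

Definition gaussian_shift_experiment (E : set (L2 P))
    (Q : E -> probability (paths E) R) : Prop :=
  exists d' (Omega : measurableType d') (Pr : probability Omega R)
         (Delta : E -> Omega -> R),
    isonormal Pr Delta /\
    forall (h : E) (A : set (paths E)), measurable A ->
      Q h A = Pr [set w | A (fun g => Delta g w + inner (val h) (val g))].

Definition inclusion (E F : set (L2 P)) (FE : F `<=` E) (f : F) : E :=
  exist _ (val f) (mem_set (FE _ (set_mem (valP f)))).

(* Equivalence of the experiment on [E] with the product of those on [F] and
   [G], for [E] the direct sum of [F] and [G]: [h] corresponds to its pair of
   components [(k h, p h)], and the observations are carried to each other by
   two measurable maps that do not involve [h]. *)
Definition independent_product (E F G : set (L2 P)) (FE : F `<=` E) (GE : G `<=` E)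
    (QE : E -> probability (paths E) R) (QF : F -> probability (paths F) R)
    (QG : G -> probability (paths G) R) : Prop :=
  exists (k : E -> F) (p : E -> G),
    let restrict (x : paths E) : paths F * paths G :=
      (fun f => x (inclusion FE f), fun g => x (inclusion GE g)) in
    let glue (y : paths F * paths G) : paths E :=
      fun h => y.1 (k h) + y.2 (p h) in
    [/\ forall (h : E) (f : F) (g : G),
          val h = val f + val g <-> f = k h /\ g = p h,
        measurable_fun setT restrict,
        measurable_fun setT glue,
        forall (h : E) (A : set (paths F * paths G)), measurable A ->
          QE h (restrict @^-1` A) = (QF (k h) \x QG (p h))%E A
      & forall (h : E) (A : set (paths E)), measurable A ->
          (QF (k h) \x QG (p h))%E (glue @^-1` A) = QE h A].

End GaussianShift.

(* Main.v *)
Require Import Defs.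
From mathcomp Require Import all_boot all_order all_algebra.
From mathcomp Require Import all_classical all_reals all_analysis.
From mathcomp Require Import measurable_realfun.
From mathcomp Require Import ring lra.

(* By additivity along the core, the core is a closed subspace on which [gamma] is
   linear; closedness needs the continuity of [gamma], which follows by a
   diagonal argument: if [u n] tends to [h], the DQM paths with scores [u n] can
   be spliced into one DQM path with score [h], along which the difference
   quotients of [Psi] are close to the [gamma (u n)]. The Riesz representation
   theorem (by minimizing [|h|^2 / 2 - gamma h]) then gives the representer, and
   also the orthogonal projection onto the core.

   The laws of the Gaussian-shift experiments are identified through Laplace
   transforms: the integral of [exp L] for a finite linear combination [L] of
   coordinates is [exp (<h, G> + |G|^2 / 2)], where [G] is the same linear
   combination of the indices, and this expression is multiplicative over
   orthogonal summands. That the Laplace transform determines a measure is shown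
   by generating all indicators from exponentials by dominated limits:
   [n (exp (L / n) - 1)] gives [L], its Taylor polynomials give [sin L], and
   polynomials in [sin (L / n)] give the indicator of [L < 0]. *)

Import Order.TTheory GRing.Theory Num.Theory.
Import numFieldNormedType.Exports.

Local Open Scope classical_set_scope.
Local Open Scope ring_scope.

Set Implicit Arguments.
Unset Strict Implicit.
Unset Printing Implicit Defensive.

(** * The Hilbert space [L2 P] *)

Section L2Inner.
Context d (X : measurableType d) (R : realType) (P : probability X R).
Implicit Types f g u v w : L2 P.

Lemma L2_Lfun f : (f : X -> R) \in Lfun P 2%:E.
Proof. exact: Lspace_repr_Lfun. Qed.

Lemma measurable_L2 f : measurable_fun [set: X] (f : X -> R).
Proof. by have /andP[] := L2_Lfun f; rewrite inE. Qed.

Lemma L2_mul_integrable f g : P.-integrable setT (fun x => (f x * g x)%:E).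
Proof. exact/Lfun1_integrable/(Lfun2_mul_Lfun1 (L2_Lfun f) (L2_Lfun g)). Qed.

Lemma L2_integrable f : P.-integrable setT (fun x => (f x)%:E).
Proof.
apply/Lfun1_integrable; apply: Lfun_subset12 (L2_Lfun f).
exact: fin_num_measure.
Qed.

Lemma eq_L2 f g : (f : X -> R) = g %[ae P] -> f = g.
Proof. by move=> fg; apply/Lspace_eqP. Qed.

Definition L2_of (f : X -> R) (Lf : f \in Lfun P 2%:E) : L2 P :=
  Lclass (Lfun_Sub (lee1n 2) Lf).

Lemma L2_ofE (f : X -> R) (Lf : f \in Lfun P 2%:E) :
  (L2_of Lf : X -> R) = f %[ae P].
Proof. exact: LclassE. Qed.

Lemma eq_ae_Rintegral (f g : X -> R) : measurable_fun setT f ->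
  measurable_fun setT g -> f = g %[ae P] -> \int[P]_x f x = \int[P]_x g x.
Proof.
move=> mf mg fg; congr fine; apply: ae_eq_integral => //.
- exact/measurable_EFinP.
- exact/measurable_EFinP.
- by apply: filterS fg => x /= /[apply] ->.
Qed.

Lemma innerC f g : inner f g = inner g f.
Proof. by apply: eq_Rintegral => x _; rewrite mulrC. Qed.

Lemma innerDl u v w : inner (u + v) w = inner u w + inner v w.
Proof.
rewrite /inner -RintegralD//; try exact: L2_mul_integrable.
apply: eq_ae_Rintegral.
- by apply: measurable_funM; exact: measurable_L2.
- by apply: measurable_funD; apply: measurable_funM; exact: measurable_L2.
- by apply: filterS (Lspace_addE u v) => x /= /[apply] ->; rewrite mulrDl.
Qed.

Lemma innerZl a u w : inner (a *: u) w = a * inner u w.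
Proof.
rewrite /inner -RintegralZl//; last exact: L2_mul_integrable.
apply: eq_ae_Rintegral.
- by apply: measurable_funM; exact: measurable_L2.
- apply: measurable_funM => //.
  by apply: measurable_funM; exact: measurable_L2.
- by apply: filterS (Lspace_scaleE a u) => x /= /[apply] ->; rewrite mulrA.
Qed.

Lemma innerDr u v w : inner w (u + v) = inner w u + inner w v.
Proof. by rewrite innerC innerDl !(innerC w). Qed.

Lemma innerZr a u w : inner w (a *: u) = a * inner w u.
Proof. by rewrite innerC innerZl (innerC w). Qed.

Lemma innerNl u w : inner (- u) w = - inner u w.
Proof. by rewrite -scaleN1r innerZl mulN1r. Qed.

Lemma innerNr u w : inner w (- u) = - inner w u.
Proof. by rewrite innerC innerNl innerC. Qed.

Lemma inner0l w : inner 0 w = 0.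
Proof. by rewrite -(scale0r 0) innerZl mul0r. Qed.

Lemma inner0r w : inner w 0 = 0.
Proof. by rewrite innerC inner0l. Qed.

Definition innerE := (innerDl, innerDr, innerNl, innerNr, innerZl, innerZr).

Lemma inner_ge0 f : 0 <= inner f f.
Proof. by apply: Rintegral_ge0 => x _; rewrite -expr2 sqr_ge0. Qed.

Lemma inner_eq0 f : inner f f = 0 -> f = 0.
Proof.
move=> f0; apply: eq_L2; apply: ae_eq_trans (ae_eq_sym (Lspace_zeroE _ _)).
have mff : measurable_fun setT (fun x => (f x * f x)%:E).
  by apply/measurable_EFinP/measurable_funM; exact: measurable_L2.
have h := (ae_eq_integral_abs P measurableT mff).1.
have /h : (\int[P]_x `|(f x * f x)%:E| = 0)%E.
  have fin := integrable_fin_num measurableT (L2_mul_integrable f f).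
  transitivity (\int[P]_x (f x * f x)%:E)%E.
    by apply: eq_integral => x _; rewrite gee0_abs// lee_fin -expr2; exact: sqr_ge0.
  by rewrite -(fineK fin); congr EFin.
apply: filterS => x /= /[apply] -[] /eqP; rewrite mulf_eq0 orbb => /eqP.
by [].
Qed.

Lemma L2norm_ge0 f : 0 <= L2norm f.
Proof. exact: sqrtr_ge0. Qed.

Lemma sqr_L2norm f : L2norm f ^+ 2 = inner f f.
Proof. exact/sqr_sqrtr/inner_ge0. Qed.

Lemma L2norm_eq0 f : L2norm f = 0 -> f = 0.
Proof. by move=> f0; apply: inner_eq0; rewrite -sqr_L2norm f0 expr0n. Qed.

Lemma L2normZ a f : L2norm (a *: f) = `|a| * L2norm f.
Proof.
rewrite /L2norm innerZl innerZr mulrA -expr2 sqrtrM ?sqr_ge0//.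
by rewrite sqrtr_sqr.
Qed.

Lemma L2norm0 : L2norm (0 : L2 P) = 0.
Proof. by rewrite /L2norm inner0l sqrtr0. Qed.

Lemma L2normN f : L2norm (- f) = L2norm f.
Proof. by rewrite -scaleN1r L2normZ normrN1 mul1r. Qed.

Lemma L2norm_distC f g : L2norm (f - g) = L2norm (g - f).
Proof. by rewrite -opprB L2normN. Qed.

Lemma L2_CauchySchwarz f g : `|inner f g| <= L2norm f * L2norm g.
Proof.
have [g0|g0] := eqVneq (L2norm g) 0.
  by rewrite g0 (L2norm_eq0 g0) inner0r normr0 mulr0.
rewrite -(@ler_pXn2r _ 2)// ?nnegrE ?mulr_ge0 ?L2norm_ge0//.
rewrite real_normK ?num_real// exprMn !sqr_L2norm.
have g1 : 0 < inner g g by rewrite -sqr_L2norm exprn_even_gt0.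
(* The squared norm of this vector is [inner g g] times the difference of the two sides of the
   squared inequality. *)
have := inner_ge0 (inner g g *: f - inner f g *: g).
rewrite !innerE (innerC g f) => h.
rewrite -subr_ge0 -(pmulr_rge0 _ g1).
by move: h; congr (_ <= _); ring.
Qed.

Lemma L2norm_triangle f g : L2norm (f + g) <= L2norm f + L2norm g.
Proof.
rewrite -(@ler_pXn2r _ 2)// ?nnegrE ?addr_ge0 ?L2norm_ge0//.
rewrite sqrrD !sqr_L2norm !innerE (innerC g f).
have := le_trans (ler_norm _) (L2_CauchySchwarz f g).
lra.
Qed.

(** Cauchy-Schwarz for [|f|] and the constant 1, which has norm 1 because [P] is a probability. *)
Lemma Rintegral_norm_le f : \int[P]_x `|f x| <= L2norm f.
Proof.
have Lnf : (fun x => `|f x|) \in Lfun P 2%:E.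
  have /andP[] := L2_Lfun f; rewrite !inE/= => mf ff.
  apply/andP; split; rewrite inE/=; first exact: measurableT_comp.
  rewrite /finite_norm.
  by under [X in 'N[_]__[X]%E]eq_fun do rewrite /= -abse_EFin; rewrite Lnorm_abse.
have L1 : (fun=> 1) \in Lfun P 2%:E by exact: Lfun_cst.
have := L2_CauchySchwarz (L2_of Lnf) (L2_of L1).
have -> : inner (L2_of Lnf) (L2_of L1) = \int[P]_x `|f x|.
  apply: eq_ae_Rintegral.
  - by apply: measurable_funM; exact: measurable_L2.
  - by apply: measurableT_comp => //; exact: measurable_L2.
  - apply: filterS2 (L2_ofE Lnf) (L2_ofE L1) => x /= h1 h2 _.
    by rewrite h1// h2// mulr1.
have -> : L2norm (L2_of Lnf) = L2norm f.
  congr Num.sqrt; apply: eq_ae_Rintegral.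
  - by apply: measurable_funM; exact: measurable_L2.
  - by apply: measurable_funM; exact: measurable_L2.
  - apply: filterS (L2_ofE Lnf) => x /= h1 _.
    by rewrite h1// -normrM ger0_norm// -expr2 sqr_ge0.
have -> : L2norm (L2_of L1) = 1.
  rewrite -[RHS]sqrtr1; congr Num.sqrt.
  transitivity (\int[P]_x (1 : R)).
    apply: eq_ae_Rintegral => //.
    - by apply: measurable_funM; exact: measurable_L2.
    - apply: filterS (L2_ofE L1) => x /= h1 _.
      by rewrite h1// mulr1.
  by rewrite Rintegral_cst//= probability_setT mul1r.
by rewrite mulr1; apply: le_trans; exact: ler_norm.
Qed.

End L2Inner.

(** * Completeness of [L2 P] along geometrically Cauchy sequences *)

Section L2Complete.
Context d (X : measurableType d) (R : realType) (P : probability X R).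
Implicit Types f g u v w : L2 P.

Lemma sqr_integrable_Lfun (g : X -> R) : measurable_fun setT g ->
  (\int[P]_x (g x ^+ 2)%:E < +oo)%E -> g \in Lfun P 2%:E.
Proof.
move=> mg ig; apply/andP; split; rewrite inE//= /finite_norm unlock.
apply: poweR_lty; under eq_integral do rewrite /= powR_mulrn// real_normK ?num_real//.
exact: ig.
Qed.

Lemma sum_halfX (n m : nat) : \sum_(0 <= i < m) (2^-1 : R) ^+ (n + i) =
  2 * 2^-1 ^+ n - 2 * 2^-1 ^+ (n + m).
Proof.
elim: m => [|m IH]; first by rewrite big_geq// addn0 subrr.
rewrite big_nat_recr//= IH addnS exprS; lra.
Qed.

Lemma L2norm_geometric (u : nat -> L2 P) (n m : nat) :
  (forall n, L2norm (u n.+1 - u n) <= 2^-1 ^+ n) ->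
  L2norm (u (n + m)%N - u n) <= 2 * 2^-1 ^+ n.
Proof.
move=> h; suff : L2norm (u (n + m)%N - u n) <= \sum_(0 <= i < m) 2^-1 ^+ (n + i).
  by move=> /le_trans; apply; rewrite sum_halfX gerBl mulr_ge0.
elim: m => [|m IH]; first by rewrite big_geq// addn0 subrr L2norm0.
rewrite big_nat_recr//= addnS.
rewrite -(subrKA (u (n + m)%N)) addrC.
by apply: le_trans (L2norm_triangle _ _) _; exact: lerD.
Qed.

(** The sum [G] of the increments [|u n.+1 - u n|] has integral at most 2, hence is finite almost
    everywhere; where it is finite, the telescoping series of [u] converges absolutely. *)
Lemma ae_cvg_geometric (u : nat -> L2 P) :
  (forall n, L2norm (u n.+1 - u n) <= 2^-1 ^+ n) ->
  exists g : X -> R, measurable_fun setT g /\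
    {ae P, forall x, u ^~ x @ \oo --> g x}.
Proof.
move=> hu.
pose dd n x := (`|u n.+1 x - u n x|)%:E.
have mdd n : measurable_fun setT (dd n).
  apply/measurable_EFinP; apply: measurableT_comp => //.
  by apply: measurable_funB; exact: measurable_L2.
have dd0 n x : setT x -> (0 <= dd n x)%E by rewrite lee_fin.
pose G x := (\sum_(0 <= n <oo) dd n x)%E.
have mG : measurable_fun setT G.
  exact: (@ge0_emeasurable_sum _ _ _ _ dd predT (fun k x h _ => dd0 k x h)
    (fun k _ => mdd k)).
have G0 x : (0 <= G x)%E by apply: nneseries_ge0 => n _ _; exact: dd0.
have intd n : (\int[P]_x dd n x <= (2^-1 ^+ n)%:E)%E.
  have := le_trans (Rintegral_norm_le (u n.+1 - u n)) (hu n).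
  rewrite -lee_fin; apply: le_trans.
  have iu : P.-integrable setT (fun x => `|((u n.+1 - u n : L2 P) x)%:E|%E).
    exact/integrable_abse/L2_integrable.
  rewrite /Rintegral fineK; last exact: (integrable_fin_num measurableT iu).
  rewrite le_eqVlt; apply/orP; left; apply/eqP.
  apply: ge0_ae_eq_integral => //.
  - by apply/measurable_EFinP; apply: measurableT_comp => //; exact: measurable_L2.
  - by move=> x; exact: dd0.
  - apply: filterS2 (Lspace_addE (u n.+1) (- u n)) (Lspace_oppE (u n)) => x.
    by move=> /= h1 h2 _; rewrite /dd h1// h2.
have intG : (\int[P]_x G x < +oo)%E.
  rewrite integral_nneseries//; apply: (@le_lt_trans _ _ 2%:E); last exact: ltry.
  apply: lime_le.
    by apply: is_cvg_nneseries => n _ _; apply: integral_ge0 => x _; exact: dd0.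
  apply: nearW => N.
  apply: (@le_trans _ _ (\sum_(0 <= i < N) (2^-1 ^+ (0 + i))%:E)%E).
    by apply: lee_sum => i _; exact: intd.
  by rewrite sumEFin lee_fin sum_halfX mulr1 gerBl mulr_ge0.
have iG : P.-integrable setT G.
  apply/integrableP; split => //.
  by under eq_integral do rewrite gee0_abs//.
have aeG := integrable_ae measurableT iG.
pose D := [set x | G x \is a fin_num].
have mD : measurable D.
  rewrite -[D]setTI; exact: emeasurable_fin_num.
(* Setting the sequence to 0 off [D] makes it converge everywhere, so that its pointwise limit is
   measurable. *)
pose f n : X -> R := (fun x => u n x) \_ D.
have fcvg x : cvgn (f ^~ x).
  have [xD|xD] := boolP (x \in D); last first.
    rewrite (_ : f^~ x = cst 0); first exact: is_cvg_cst.
    by apply/funext => n; rewrite /f patchE (negbTE xD).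
  rewrite (_ : f^~ x = (fun n => u n x)); last first.
    by apply/funext => n; rewrite /f patchE xD.
  have -> : (fun n => u n x) =
      (fun n => u 0%N x + series (telescope (fun n => u n x)) n).
    by apply/funext => n; exact: (eq_sum_telescope (fun n => u n x)).
  apply: is_cvgD; first exact: is_cvg_cst.
  apply: normed_cvg; apply: nondecreasing_is_cvgn.
    by apply/nondecreasing_series => n _ _ /=.
  exists (fine (G x)) => _ [n _ <-].
  rewrite -lee_fin fineK; last by move: xD; rewrite inE.
  have := @nneseries_lim_ge _ (dd ^~ x) predT 0 n (fun n _ _ => dd0 n x I).
  by rewrite sumEFin.
exists (fun x => limn (f ^~ x)); split.
  apply: (@measurable_fun_cvg _ _ _ _ f).
    by move=> n; apply/(measurable_restrictT _ mD).1/measurable_funTS/measurable_L2.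
  by move=> x _; exact: fcvg.
apply: filterS aeG => x /(_ I) Gx.
rewrite (_ : u^~ x = f^~ x); first exact: fcvg.
by apply/funext => n; rewrite /f patchE mem_set.
Qed.

(** Fatou's lemma as [m] tends to infinity turns the bound on [u n - u (n + m)] into the same bound
    on [u n - g], with [g] the almost everywhere limit. *)
Lemma L2_complete_geometric (u : nat -> L2 P) :
  (forall n, L2norm (u n.+1 - u n) <= 2^-1 ^+ n) ->
  exists v, forall n, L2norm (u n - v) <= 2 * 2^-1 ^+ n.
Proof.
move=> hu; have [g [mg ug]] := ae_cvg_geometric hu.
have sq n m : (\int[P]_x ((u n x - u (n + m)%N x) ^+ 2)%:E <= ((2 * 2^-1 ^+ n) ^+ 2)%:E)%E.
  have := L2norm_geometric n m hu; rewrite L2norm_distC => h.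
  have : L2norm (u n - u (n + m)%N) ^+ 2 <= (2 * 2^-1 ^+ n) ^+ 2.
    by rewrite ler_pXn2r// ?nnegrE ?L2norm_ge0// mulr_ge0.
  rewrite -lee_fin; apply: le_trans.
  rewrite sqr_L2norm /inner /Rintegral fineK; last first.
    exact/(integrable_fin_num measurableT)/L2_mul_integrable.
  rewrite le_eqVlt; apply/orP; left; apply/eqP.
  apply: ge0_ae_eq_integral => //.
  - apply/measurable_EFinP/measurable_funX.
    by apply: measurable_funB; exact: measurable_L2.
  - by apply/measurable_EFinP/measurable_funM; exact: measurable_L2.
  - by move=> x _; rewrite lee_fin sqr_ge0.
  - by move=> x _; rewrite lee_fin -expr2 sqr_ge0.
  - apply: filterS2 (Lspace_addE (u n) (- u (n + m)%N)) (Lspace_oppE (u (n + m)%N)) => x.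
    by move=> /= h1 h2 _; rewrite h1// h2.
have sqg n : (\int[P]_x ((u n x - g x) ^+ 2)%:E <= ((2 * 2^-1 ^+ n) ^+ 2)%:E)%E.
  pose F m x := ((u n x - u (n + m)%N x) ^+ 2)%:E.
  have mF m : measurable_fun setT (F m).
    apply/measurable_EFinP/measurable_funX.
    by apply: measurable_funB; exact: measurable_L2.
  have F0 m x : setT x -> (0 <= F m x)%E by rewrite lee_fin sqr_ge0.
  have := fatou P measurableT mF F0.
  have -> : (\int[P]_x limn_einf (F ^~ x) = \int[P]_x ((u n x - g x) ^+ 2)%:E)%E.
    apply: ae_eq_integral => //.
    - rewrite (_ : (fun x => _) = (fun x => limn (einfs (F^~ x)))); last first.
        by apply/funext => x; rewrite limn_einf_lim.
      apply: (@emeasurable_fun_cvg _ _ _ _ (fun m x => einfs (F^~ x) m)).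
        by move=> m; exact: measurable_fun_einfs.
      by move=> x _; exact: is_cvg_einfs.
    - apply/measurable_EFinP/measurable_funX.
      by apply: measurable_funB => //; exact: measurable_L2.
    - apply: filterS ug => x ux _.
      have Fc : F^~ x @ \oo --> ((u n x - g x) ^+ 2)%:E.
        apply: cvg_EFin; first exact: nearW.
        rewrite /F /comp/=.
        apply: (@cvg_comp _ _ _ (fun m => u n x - u (n + m)%N x)
          (fun y : R => y ^+ 2) _ (nbhs (u n x - g x))); last first.
          exact: sqr_continuous.
        apply: cvgB; first exact: cvg_cst.
        rewrite (_ : (fun m => _) = (fun m => u (m + n)%N x)); last first.
          by apply/funext => m; rewrite addnC.
        exact: (cvg_comp _ _ (cvg_addnr n) ux).
      rewrite is_cvg_limn_einfE; first exact/cvg_lim.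
      by apply/cvg_ex; eexists; exact: Fc.
  move=> /le_trans; apply.
  rewrite limn_einf_lim; apply: lime_le; first exact: is_cvg_einfs.
  apply: nearW => m; apply: (@le_trans _ _ (\int[P]_x F m x)%E); last exact: sq.
  by apply: ereal_inf_lbound; exists m => /=.
have mgu : measurable_fun setT (fun x => u 0%N x - g x).
  by apply: measurable_funB => //; exact: measurable_L2.
have Lw := sqr_integrable_Lfun mgu (le_lt_trans (sqg 0%N) (ltry _)).
(* The case [n = 0] of [sqg] makes [u 0 - g] square integrable; subtracting its class from [u 0]
   yields the class of [g]. *)
exists (u 0%N - L2_of Lw) => n.
rewrite -(@ler_pXn2r _ 2)// ?nnegrE ?L2norm_ge0 ?mulr_ge0//.
rewrite sqr_L2norm /inner -lee_fin.
rewrite /Rintegral fineK; last first.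
  exact/(integrable_fin_num measurableT)/L2_mul_integrable.
apply: le_trans (sqg n).
rewrite le_eqVlt; apply/orP; left; apply/eqP.
apply: ge0_ae_eq_integral => //.
- by apply/measurable_EFinP/measurable_funM; exact: measurable_L2.
- apply/measurable_EFinP/measurable_funX.
  by apply: measurable_funB => //; exact: measurable_L2.
- by move=> x _; rewrite lee_fin -expr2 sqr_ge0.
- by move=> x _; rewrite lee_fin sqr_ge0.
- have h1 := Lspace_addE (u n) (- (u 0%N - L2_of Lw)).
  have h2 := Lspace_oppE (u 0%N - L2_of Lw).
  have h3 := Lspace_addE (u 0%N) (- L2_of Lw).
  have h4 := Lspace_oppE (L2_of Lw).
  have h5 := L2_ofE Lw.
  near=> x; move=> _.
  have -> : ((u n - (u 0%N - L2_of Lw) : L2 P) : X -> R) x = u n x - g x.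
    rewrite (near h1 x _)//= (near h2 x _)//= (near h3 x _)//= (near h4 x _)//=.
    by rewrite (near h5 x _)//=; ring.
  by rewrite expr2.
Unshelve. all: end_near.
Qed.

End L2Complete.

(** * Riesz representation and orthogonal projection *)

Section Riesz.
Context d (X : measurableType d) (R : realType) (P : probability X R).
Implicit Types (E : set (L2 P)) (f g u v w : L2 P).

Lemma halfX_small (K e : R) : 0 < e -> exists n : nat, K * 2^-1 ^+ n < e.
Proof.
move=> e0; have [K0|K0] := leP K 0.
  by exists 0%N; rewrite expr0 mulr1 (le_lt_trans K0).
exists (Num.truncn (K / e)).+1.
rewrite exprVn ltr_pdivrMr ?exprn_gt0// mulrC -ltr_pdivrMr//.
apply: lt_trans (truncnS_gt _) _.
by rewrite -natrX ltr_nat ltn_expl.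
Qed.

Lemma le_halfX_eq0 (K b : R) : (forall n, `|b| <= K * 2^-1 ^+ n) -> b = 0.
Proof.
move=> h; apply/eqP; apply: contraT => b0.
have /(halfX_small K)[n] : 0 < `|b| by rewrite normr_gt0.
by rewrite ltNge h.
Qed.

Lemma linear_subspaceD E u v : linear_subspace E -> E u -> E v -> E (u + v).
Proof. by move=> [_ h] Eu Ev; rewrite -(scale1r u); exact: h. Qed.

Lemma linear_subspaceZ E a u : linear_subspace E -> E u -> E (a *: u).
Proof. by move=> [h0 h] Eu; rewrite -(addr0 (a *: u)); exact: h. Qed.

Lemma linear_subspaceN E u : linear_subspace E -> E u -> E (- u).
Proof. by move=> lE Eu; rewrite -scaleN1r; exact: linear_subspaceZ. Qed.

Lemma linear_subspaceB E u v : linear_subspace E -> E u -> E v -> E (u - v).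
Proof. by move=> lE Eu Ev; apply: linear_subspaceD => //; exact: linear_subspaceN. Qed.

Section MinimizingSequence.
Variables (E : set (L2 P)) (L : L2 P -> R) (C : R).
Hypothesis lE : linear_subspace E.
Hypothesis L_lin : forall a u v, E u -> E v -> L (a *: u + v) = a * L u + L v.
Hypothesis L_bnd : forall u, E u -> `|L u| <= C * L2norm u.

(** Twice the functional [|u|^2 / 2 - L u], whose minimizer over [E] is the representer of [L]. *)
Let J u := inner u u - 2 * L u.
Let eps n : R := (2^-1 ^+ n.+1) ^+ 2.

Let L0 : L 0 = 0.
Proof. have := L_lin 1 lE.1 lE.1; rewrite scale1r addr0 mul1r; lra. Qed.

Let LZ a u : E u -> L (a *: u) = a * L u.
Proof. by move=> Eu; have := L_lin a Eu lE.1; rewrite L0 !addr0. Qed.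

Let LD u v : E u -> E v -> L (u + v) = L u + L v.
Proof. by move=> Eu Ev; have := L_lin 1 Eu Ev; rewrite scale1r mul1r. Qed.

Let J_ge u : E u -> - C ^+ 2 <= J u.
Proof.
move=> Eu; rewrite /J -sqr_L2norm.
have := le_trans (ler_norm _) (L_bnd Eu); set N := L2norm u => h.
have := sqr_ge0 (N - C); nra.
Qed.

Let JE : has_inf (J @` E).
Proof.
split; first by exists (J 0); exists 0 => //; exact: lE.1.
by exists (- C ^+ 2) => _ [u Eu <-]; exact: J_ge.
Qed.

Let m := inf (J @` E).

Let m_le u : E u -> m <= J u.
Proof. by move=> Eu; apply: ge_inf; [exact: JE.2|exists u]. Qed.

Let minimizing n : exists u, E u /\ J u < m + eps n.
Proof.
have [|_ [u Eu <-] h] := @inf_adherent _ _ (eps n) _ JE; last by exists u.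
by rewrite exprn_gt0// exprn_gt0.
Qed.

(** Near-minimizers of [J] are Cauchy by the parallelogram identity. Since [J] can decrease by at
    most [eps n] from [u n] along any direction [w], half of its derivative there,
    [inner (u n) w - L w], is small. *)
Lemma minimizing_sequence : exists u : nat -> L2 P,
  [/\ forall n, E (u n), forall n, L2norm (u n.+1 - u n) <= 2^-1 ^+ n
    & forall n w, E w -> `|inner (u n) w - L w| <= (1 + L2norm w) * 2^-1 ^+ n].
Proof.
have [u hu] := choice minimizing.
have Eu n : E (u n) by have [] := hu n.
have r0 n : 0 <= (2^-1 : R) ^+ n by rewrite exprn_ge0.
exists u; split=> // [n|n w Ew].
  rewrite -(@ler_pXn2r _ 2)// ?nnegrE ?L2norm_ge0// sqr_L2norm.
  have [_ h1] := hu n; have [_ h2] := hu n.+1.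
  (* [J] at the midpoint is at least [m], so [|u n.+1 - u n|^2 <= 2 * (eps n + eps n.+1)], which is
     5/8 of the square of [2^-1 ^+ n]. *)
  have := m_le (linear_subspaceZ 2^-1 lE (linear_subspaceD lE (Eu n) (Eu n.+1))).
  move: h1 h2; rewrite /J LZ ?LD//; last exact: linear_subspaceD.
  rewrite /eps !innerE (innerC (u n.+1) (u n)).
  set p := (2^-1 : R) ^+ n; rewrite [_ ^+ n.+2]exprS [_ ^+ n.+1]exprS -/p.
  have : 0 <= p ^+ 2 by exact: sqr_ge0.
  rewrite !expr2; lra.
have N0 := L2norm_ge0 w.
set b := inner (u n) w - L w.
have W1 : 0 < L2norm w ^+ 2 + 1 by rewrite ltr_wpDl// sqr_ge0.
have b2 : b ^+ 2 <= eps n * (L2norm w ^+ 2 + 1).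
  (* The minimizer of [J] on the line through [u n] would be at [- b / L2norm w ^+ 2]; the added 1
     also covers [w = 0]. *)
  pose t := - b / (L2norm w ^+ 2 + 1).
  have := m_le (linear_subspaceD lE (Eu n) (linear_subspaceZ t lE Ew)).
  have [_] := hu n; rewrite /J LD// ?LZ//; last exact: linear_subspaceZ.
  rewrite !innerE (innerC w (u n)) -(sqr_L2norm w) => h1 h2.
  have {h1 h2} h : - eps n <= t * t * L2norm w ^+ 2 + 2 * t * b by rewrite /b; lra.
  have tW : t * (L2norm w ^+ 2 + 1) = - b by rewrite /t divfK// gt_eqF.
  set W := L2norm w ^+ 2 in h tW W1 *.
  have W0 : 0 <= W by exact: sqr_ge0.
  have -> : b ^+ 2 = (t * (W + 1)) ^+ 2 by rewrite tW sqrrN.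
  have bE : b = - (t * (W + 1)) by rewrite tW opprK.
  have e0 : 0 <= eps n by exact: sqr_ge0.
  have : t ^+ 2 * (W + 2) <= eps n by move: h; rewrite bE; nra.
  have t2 : 0 <= t ^+ 2 by exact: sqr_ge0.
  move=> h'; rewrite exprMn (_ : (W + 1) ^+ 2 = (W + 1) * (W + 1)) ?expr2// mulrA.
  by rewrite ler_pM2r//; nra.
rewrite -(@ler_pXn2r _ 2)// ?nnegrE ?mulr_ge0 ?addr_ge0//.
rewrite real_normK ?num_real//; apply: le_trans b2 _.
rewrite /eps (exprS _ n); set p := 2^-1 ^+ n; have := r0 n; rewrite -/p => p0.
have p2 : 0 <= p ^+ 2 by exact: sqr_ge0.
have Np : 0 <= L2norm w * p ^+ 2 by exact: mulr_ge0.
have NNp : 0 <= L2norm w ^+ 2 * p ^+ 2 by exact: mulr_ge0 (sqr_ge0 _) p2.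
by move: p2 Np NNp; rewrite !exprMn; lra.
Qed.

End MinimizingSequence.

(** The limit of the minimizing sequence lies in [E] by closedness, and the approximate identity
    satisfied by [u n] becomes exact for it. *)
Lemma riesz_representation E (L : L2 P -> R) (C : R) :
  linear_subspace E -> L2_closed E ->
  (forall a u v, E u -> E v -> L (a *: u + v) = a * L u + L v) ->
  (forall u, E u -> `|L u| <= C * L2norm u) ->
  exists psi, riesz_representer E L psi.
Proof.
move=> lE cE L_lin L_bnd.
have [u [Eu u_cauchy uL]] := minimizing_sequence lE L_lin L_bnd.
have [v uv] := L2_complete_geometric u_cauchy.
exists v; split.
  apply: cE => e /(halfX_small 2)[n hn]; exists (u n) => //.
  by rewrite L2norm_distC; exact: le_lt_trans (uv n) hn.
move=> w Ew; apply/esym/eqP; rewrite -subr_eq0; apply/eqP.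
(* [1 + L2norm w] comes from the error of [u n], and [2 * L2norm w] from replacing [u n] by its
   limit [v]. *)
apply: (@le_halfX_eq0 (1 + 3 * L2norm w)) => n.
have -> : inner v w - L w = inner (v - u n) w + (inner (u n) w - L w).
  by rewrite !innerE; ring.
apply: le_trans (ler_normD _ _) _.
have h1 := uL n w Ew.
have h2 := L2_CauchySchwarz (v - u n) w.
have h3 := uv n; rewrite L2norm_distC in h3.
have := ler_wpM2r (L2norm_ge0 w) h3; nra.
Qed.

(** The projection is the representer of [inner u] restricted to [E]. *)
Lemma orthogonal_projection E u : linear_subspace E -> L2_closed E ->
  exists2 v, E v & orthocomplement E (u - v).
Proof.
move=> lE cE.
have [|w _|v [Ev uv]] := @riesz_representation E (inner u) (L2norm u) lE cE.
- by move=> a v w _ _; rewrite !innerE.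
- exact: L2_CauchySchwarz.
- by exists v => // w Ew; rewrite !innerE uv// subrr.
Qed.

End Riesz.

(** * Continuity of the directional derivative *)

Section DqmRemainder.
Local Open Scope charge_scope.
Context d (X : measurableType d) (R : realType).
Variables (P Q : probability X R).
Implicit Types h : L2 P.
Local Notation mu := (dominating P Q).

Lemma dominating_dominates : P `<< mu.
Proof.
apply/null_content_dominatesP => A mA h.
have {}h : mu A = 0 by exact: h.
by apply/eqP; rewrite eq_le measure_ge0 andbT -h /dominating measure_addE leeDl.
Qed.

Lemma dominating_dominates2 : Q `<< mu.
Proof.
apply/null_content_dominatesP => A mA h.
have {}h : mu A = 0 by exact: h.
by apply/eqP; rewrite eq_le measure_ge0 andbT -h /dominating measure_addE leeDr.
Qed.

Lemma measurable_sqrt_density (Q' : probability X R) : Q' `<< mu ->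
  measurable_fun setT (sqrt_density mu Q').
Proof.
move=> dom; apply: (measurableT_comp (f := @Num.sqrt R)).
  by apply: continuous_measurable_fun; exact: sqrt_continuous.
apply: measurableT_comp; first exact: fine_measurable.
exact: (measurable_int mu (Radon_Nikodym_integrable _)).
Qed.

(** The squared root density is the density of [P] with respect to [mu], so this is a change of
    variables; it expresses norms in [L2 P] under the dominating measure of the DQM remainder. *)
Lemma integral_sqrt_density (g : X -> R) : measurable_fun setT g ->
  (\int[mu]_x (g x ^+ 2 * sqrt_density mu P x ^+ 2)%:E = \int[P]_x (g x ^+ 2)%:E)%E.
Proof.
move=> mg; have dom := dominating_dominates.
rewrite -(Radon_Nikodym_SigmaFinite.change_of_variables dom)//; last first.
- exact/measurable_EFinP/measurable_funX.
- by move=> x; rewrite lee_fin sqr_ge0.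
apply: ae_eq_integral => //.
- apply/measurable_EFinP/measurable_funM; apply: measurable_funX => //.
  exact: measurable_sqrt_density.
- apply: emeasurable_funM; first exact/measurable_EFinP/measurable_funX.
  exact: measurable_int (Radon_Nikodym_SigmaFinite.f_integrable dom).
- have := ae_eq_Radon_Nikodym_SigmaFinite dom measurableT.
  apply: filterS => x /(_ I) fx _; rewrite EFinM /sqrt_density -fx; congr (_ * _)%E.
  have f0 := Radon_Nikodym_SigmaFinite.f_ge0 dom x.
  have ff := Radon_Nikodym_SigmaFinite.f_fin_num dom x.
  by rewrite sqr_sqrtr ?fineK// fine_ge0.
Qed.

(** Replacing the score [h'] by [h] adds half of [(h' - h) dP^{1/2}] to the integrand before
    squaring; then [(a + b / 2)^2 <= 2 a^2 + b^2 / 2]. *)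
Lemma dqm_remainder_le h h' t : (dqm_remainder Q h t <=
  2%:E * dqm_remainder Q h' t + (2^-1 * L2norm (h' - h) ^+ 2)%:E)%E.
Proof.
have mp := measurable_sqrt_density dominating_dominates.
have mq := measurable_sqrt_density dominating_dominates2.
have mh := measurable_L2 h; have mh' := measurable_L2 h'.
pose r (u : L2 P) x := (sqrt_density mu Q x - sqrt_density mu P x) / t -
  2^-1 * u x * sqrt_density mu P x.
have mr u : measurable_fun setT (r u).
  apply: measurable_funB; first by apply: measurable_funM => //; exact: measurable_funB.
  by apply: measurable_funM => //; apply: measurable_funM => //; exact: measurable_L2.
have mr2 u : measurable_fun setT (fun x => (r u x ^+ 2)%:E).
  exact/measurable_EFinP/measurable_funX.
pose b x := (h' x - h x) ^+ 2 * sqrt_density mu P x ^+ 2.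
have mb : measurable_fun setT (fun x => (b x)%:E).
  apply/measurable_EFinP/measurable_funM; apply: measurable_funX => //.
  exact: measurable_funB.
have b0 x : 0 <= b x by rewrite mulr_ge0 ?sqr_ge0.
have int_b : (\int[mu]_x (b x)%:E = (L2norm (h' - h) ^+ 2)%:E)%E.
  rewrite integral_sqrt_density; last exact: measurable_funB.
  rewrite sqr_L2norm /inner /Rintegral fineK; last first.
    exact/(integrable_fin_num measurableT)/L2_mul_integrable.
  apply: ge0_ae_eq_integral => //.
  - by apply/measurable_EFinP/measurable_funX; exact: measurable_funB.
  - by apply/measurable_EFinP/measurable_funM; exact: measurable_L2.
  - by move=> x _; rewrite lee_fin sqr_ge0.
  - by move=> x _; rewrite lee_fin -expr2 sqr_ge0.
  - apply: filterS2 (Lspace_addE h' (- h)) (Lspace_oppE h) => x /= h1 h2 _.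
    by rewrite h1// h2.
have b0E x : setT x -> (0 <= (b x)%:E)%E by rewrite lee_fin b0.
have r0E u x : setT x -> (0 <= (r u x ^+ 2)%:E)%E by rewrite lee_fin sqr_ge0.
have remE u : dqm_remainder Q u t = (\int[mu]_x (r u x ^+ 2)%:E)%E by [].
have two0 : (0 <= 2%:E :> \bar R)%E by rewrite lee_fin.
have half0 : (0 <= (2^-1)%:E :> \bar R)%E by rewrite lee_fin invr_ge0.
rewrite !remE EFinM -int_b -(ge0_integralZl mu measurableT (mr2 h') (r0E h') two0).
rewrite -(ge0_integralZl mu measurableT mb b0E half0) -ge0_integralD//; last 4 first.
- by move=> x _; apply: mule_ge0 => //; exact: r0E.
- exact: measurable_funeM.
- by move=> x _; apply: mule_ge0 => //; exact: b0E.
- exact: measurable_funeM.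
apply: ge0_le_integral => //.
- exact: r0E.
- by apply: emeasurable_funD; apply: measurable_funeM.
move=> x _; rewrite -!EFinM -EFinD lee_fin.
have -> : r h x = r h' x + 2^-1 * ((h' x - h x) * sqrt_density mu P x).
  by rewrite /r; ring.
rewrite /b -exprMn; set u := r h' x; set v := _ * sqrt_density _ _ _.
by have := sqr_ge0 (u - 2^-1 * v); nra.
Qed.

End DqmRemainder.

(** * Splicing of DQM paths and continuity of the derivative *)

Section DerivativeContinuity.
Context d (X : measurableType d) (R : realType) (PP : set (probability X R)).
Context (P : probability X R).

Lemma near_right0P (A : R -> Prop) : (\forall t \near 0^'+, A t) <->
  exists2 e, 0 < e & forall t, 0 < t < e -> A t.
Proof.
split=> [|[e e0 eA]].
  move/nbhs_ballP => [e e0 eA]; exists e => // t /andP[t0 te].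
  by apply: eA => //; rewrite /ball/= sub0r normrN gtr0_norm.
near=> t; apply: eA; apply/andP; split; near: t.
  exact: nbhs_right_gt.
exact: nbhs_right_lt.
Unshelve. all: end_near.
Qed.

(** Index 0 is admissible because [t < dl 0], and [m t <= 1] bounds the admissible indices, so a
    largest one exists. *)
Lemma last_index_before (dl : nat -> R) (t : R) : 0 < t < dl 0%N ->
  exists N : nat, t < dl N /\ forall m, m%:R * t <= 1 -> t < dl m -> (m <= N)%N.
Proof.
move=> /andP[t0 td].
pose p n := `[< n%:R * t <= 1 /\ t < dl n >].
have p0 : exists n, p n by exists 0%N; apply/asboolP; rewrite mul0r.
have pub n : p n -> (n <= Num.truncn t^-1)%N.
  move/asboolP => [nt _]; rewrite -ltnS -(ltr_nat R).
  apply: le_lt_trans (truncnS_gt _).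
  by rewrite -[leRHS]div1r ler_pdivlMr.
case: (ex_maxnP p0 pub) => N /asboolP[_ tN] max; exists N; split => // m mt tm.
by apply: max; apply/asboolP.
Qed.

Section DiagonalPath.
Variables (u : nat -> L2 P) (h : L2 P).
Hypothesis uh : forall n, L2norm (u n - h) <= n.+1%:R^-1.
Variable Pn : nat -> R -> probability X R.
Hypothesis path_u : forall n, dqm_path PP (u n) (Pn n).

(* The path follows [Pn n] on a stretch of times that shrinks to 0, with [n]
   growing: [N t] is the largest [n <= 1 / t] such that the approximations for
   [u n] are already good at time [t]. *)
Lemma diagonal_path (A : nat -> R -> Prop) :
  (forall n, \forall t \near 0^'+, A n t) ->
  exists Pt (N : R -> nat), [/\ dqm_path PP h Pt,
    N t @[t --> 0^'+] --> \oo
    & \forall t \near 0^'+, Pt t = Pn (N t) t /\ A (N t) t].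
Proof.
move=> nearA.
have good n : exists dl : R, 0 < dl /\ forall t, 0 < t < dl ->
    [/\ A n t, PP (Pn n t) & (dqm_remainder (Pn n t) (u n) t <= (n.+1%:R^-1)%:E)%E].
  have [[e e0 eP] _ rem0] := path_u n.
  have nr : \forall t \near 0^'+, (dqm_remainder (Pn n t) (u n) t < (n.+1%:R^-1)%:E)%E.
    apply: (rem0 [set y | (y < (n.+1%:R^-1)%:E)%E]); apply: open_ereal_lt'.
    by rewrite lte_fin invr_gt0 ltr0n.
  have [e1 e10 h1] := (near_right0P _).1 nr.
  have [e2 e20 h2] := (near_right0P _).1 (nearA n).
  exists (Num.min e (Num.min e1 e2)); split; first by rewrite !lt_min e0 e10.
  move=> t /andP[t0]; rewrite !lt_min => /and3P[te te1 te2]; split.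
  - by apply: h2; rewrite t0.
  - by apply: eP; rewrite ltW.
  - by apply/ltW/h1; rewrite t0.
have [dl hdl] := choice good.
have dl0 n : 0 < dl n by have [] := hdl n.
have exN t : exists N, 0 < t < dl 0%N ->
    t < dl N /\ forall m, m%:R * t <= 1 -> t < dl m -> (m <= N)%N.
  have [/last_index_before[N ?]|_] := boolP (0 < t < dl 0%N); first by exists N.
  by exists 0%N.
have [N hN] := choice exN.
pose Pt t := if 0 < t then Pn (N t) t else P.
have NY : N t @[t --> 0^'+] --> \oo.
  apply/cvgnyPge => m; apply/near_right0P.
  (* Below this threshold the index [m] itself is admissible, so that [N t >= m]. *)
  exists (Num.min (dl 0%N) (Num.min (dl m) m.+1%:R^-1)).
    by rewrite !lt_min !dl0 invr_gt0 ltr0n.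
  move=> t /andP[t0]; rewrite !lt_min => /and3P[td0 tdm tm].
  have [_] := hN t (introT andP (conj t0 td0)); apply => //.
  have mt : m.+1%:R * t < 1 by rewrite mulrC -ltr_pdivlMr ?ltr0n// div1r.
  by apply: le_trans (ltW mt); rewrite ler_wpM2r ?(ltW t0)// ler_nat.
have goodN t : 0 < t < dl 0%N -> [/\ Pt t = Pn (N t) t, A (N t) t, PP (Pn (N t) t)
    & (dqm_remainder (Pn (N t) t) (u (N t)) t <= ((N t).+1%:R^-1)%:E)%E].
  move=> /[dup] /hN[tN _] /andP[t0 _]; have [_ h1] := hdl (N t).
  have [| ? ? ?] := h1 t; first by rewrite t0.
  by split => //; rewrite /Pt t0.
exists Pt, N; split => //; last first.
  by apply/near_right0P; exists (dl 0%N) => // t /goodN[].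
split.
- exists (dl 0%N) => // t /andP[]; rewrite le_eqVlt => /predU1P[<- _|t0 td].
    rewrite /Pt ltxx; have [[e e0 eP] P0 _] := path_u 0%N.
    by have := eP 0; rewrite P0; apply; rewrite lexx.
  by have [-> _ ? _] := goodN t (introT andP (conj t0 td)).
- by rewrite /Pt ltxx.
(* With [N = N t], the remainder for [u N] contributes [2 / (N + 1)] and the change of score at most
   another [1 / (N + 1)], since [L2norm (u N - h)] is at most [1 / (N + 1)], hence at most 1. *)
- apply: (@squeeze_cvge _ _ _ _ (cst 0%E) _ (fun t => (3 * harmonic (N t))%:E)).
  + apply/near_right0P; exists (dl 0%N) => // t /goodN[-> _ _ rem]; apply/andP; split.
      by apply: integral_ge0 => x _; rewrite lee_fin sqr_ge0.
    apply: le_trans (dqm_remainder_le _ h (u (N t)) t) _.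
    rewrite /harmonic /= (_ : 3 * _ = 2 * (N t).+1%:R^-1 + (N t).+1%:R^-1); last ring.
    rewrite [leRHS]EFinD; apply: leeD; first by rewrite [leRHS]EFinM lee_wpmul2l.
    have N1 : (N t).+1%:R^-1 <= 1 :> R by rewrite invf_le1 ?ltr0n// ler1n.
    have := ler_pM (L2norm_ge0 _) (L2norm_ge0 _) (le_trans (uh (N t)) N1) (uh (N t)).
    rewrite lee_fin mul1r expr2.
    have := mulr_ge0 (L2norm_ge0 (u (N t) - h)) (L2norm_ge0 (u (N t) - h)).
    by set a := L2norm _ * L2norm _; set b := _^-1; clearbody a b; lra.
  + exact: cvg_cst.
  + apply: cvg_EFin; first exact: nearW.
    rewrite /comp/= -[X in _ --> X](mulr0 3); apply: cvgM; first exact: cvg_cst.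
    exact: (cvg_comp _ _ NY (@cvg_harmonic R)).
Qed.

End DiagonalPath.

(** By contradiction: scores [u n] tending to [h] with [gamma (u n)] at least [e] away from
    [gamma h] give a spliced path with score [h]. Its difference quotients tend to [gamma h], yet
    come arbitrarily close to [gamma (u (N t))]. *)
Lemma directional_derivative_continuous (T : set (L2 P)) Psi gamma :
  directional_derivative PP T Psi gamma -> path_realization PP T ->
  forall h (e : R), T h -> 0 < e -> exists2 dl, 0 < dl &
    forall u, T u -> L2norm (u - h) < dl -> `|gamma u - gamma h| < e.
Proof.
move=> [_ deriv] [_ real] h e Th e0; apply: contrapT => ncont.
have bad (n : nat) : exists u, [/\ T u, L2norm (u - h) <= n.+1%:R^-1
    & e <= `|gamma u - gamma h|].
  apply: contrapT => nbad; apply: ncont; exists n.+1%:R^-1.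
    by rewrite invr_gt0 ltr0n.
  move=> u Tu uh; rewrite ltNge; apply/negP => eu; apply: nbad.
  by exists u; split => //; exact: ltW.
have [u hu] := choice bad.
have [Pn path_u] := choice (fun n => real (u n) (let: And3 Tu _ _ := hu n in Tu)).
(* The condition that the splice has to respect: at time [t] the quotient along [Pn n] has nearly
   reached [gamma (u n)]. *)
pose A n t := `|t^-1 * (Psi (Pn n t) - Psi P) - gamma (u n)| < n.+1%:R^-1.
have nearA n : \forall t \near 0^'+, A n t.
  have [Tu _ _] := hu n; have /cvgr_distC_lt := deriv _ _ Tu (path_u n).
  by apply; rewrite invr_gt0 ltr0n.
have uh n : L2norm (u n - h) <= n.+1%:R^-1 by have [] := hu n.
have [Pt [N [path_h NY nearN]]] := diagonal_path uh path_u nearA.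
have e2 : 0 < e / 2 by rewrite divr_gt0.
have near1 : \forall t \near 0^'+, `|t^-1 * (Psi (Pt t) - Psi P) - gamma h| < e / 2.
  by have /cvgr_distC_lt := deriv h Pt Th path_h; apply.
have near2 : \forall t \near 0^'+, (N t).+1%:R^-1 < e / 2.
  by have /cvgr_lt := cvg_comp _ _ NY (@cvg_harmonic R); apply.
have [t [h1 h2 [h3 h4]]] : exists t, [/\ `|t^-1 * (Psi (Pt t) - Psi P) - gamma h| < e / 2,
    (N t).+1%:R^-1 < e / 2 & Pt t = Pn (N t) t /\ A (N t) t].
  apply: (@filter_ex _ (0 : R)^'+).
  by near=> t; split; near: t.
have [_ _] := hu (N t); rewrite leNgt => /negP; apply.
move: h1 h4; rewrite h3 /A; set q := _ * _ => h1 h4.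
rewrite (_ : _ - _ = (q - gamma h) - (q - gamma (u (N t)))); last ring.
apply: le_lt_trans (ler_normB _ _) _; have := lt_trans h4 h2.
lra.
Unshelve. all: end_near.
Qed.

End DerivativeContinuity.

(** * The additivity space *)

Section AdditivitySpace.
Context d (X : measurableType d) (R : realType) (P : probability X R).
Variables (T : set (L2 P)) (g : L2 P -> R).
Hypotheses (T_lin : linear_subspace T) (g_hom : positively_homogeneous T g).
Local Notation A := (additivity_space T g).

Lemma positively_homogeneous0 : g 0 = 0.
Proof. by have := g_hom (lexx 0) T_lin.1; rewrite scale0r mul0r. Qed.

Lemma additivity_sub w : A w -> T w. Proof. by case. Qed.

Lemma additivityD w w' : A w -> A w' -> A (w + w').
Proof.
move=> [Tw gw] [Tw' gw']; split; first exact: linear_subspaceD.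
move=> h Th; rewrite addrA (gw' _ (linear_subspaceD T_lin Th Tw)).
by rewrite gw// gw'// addrA.
Qed.

(** Additivity at [h - w] reads [g h = g (h - w) + g w]; the case [h = 0] gives the value at
    [- w]. *)
Lemma additivityN w : A w -> A (- w) /\ g (- w) = - g w.
Proof.
move=> [Tw gw]; have TN h : T h -> T (h - w) by move=> Th; exact: linear_subspaceB.
have gB h : T h -> g (h - w) = g h - g w.
  by move=> Th; have := gw _ (TN h Th); rewrite subrK => ->; rewrite addrK.
have gN : g (- w) = - g w.
  by have := gB 0 T_lin.1; rewrite !sub0r positively_homogeneous0 sub0r.
split => //; split; first exact: linear_subspaceN.
by move=> h Th; rewrite gB// gN.
Qed.

(** For [c != 0], homogeneity pulls [c] out of [h + c *: w = c *: (c^-1 *: h + w)]. *)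
Lemma additivityZ_ge0 c w : 0 <= c -> A w -> A (c *: w).
Proof.
move=> c0 [Tw gw]; have Tcw := linear_subspaceZ c T_lin Tw; split => // h Th.
have [->|cn0] := eqVneq c 0.
  by rewrite scale0r positively_homogeneous0 !addr0.
rewrite -{1}(scalerKV cn0 h) -scalerDr.
have Tch := linear_subspaceZ c^-1 T_lin Th.
have Thw : T (c^-1 *: h + w) by exact: linear_subspaceD.
rewrite (g_hom c0 Thw) (g_hom c0 Tw).
by rewrite gw// mulrDr -(g_hom c0 Tch) scalerKV.
Qed.

Lemma additivityZ c w : A w -> A (c *: w) /\ g (c *: w) = c * g w.
Proof.
move=> Aw; have [c0|c0] := leP 0 c.
  by split; [exact: additivityZ_ge0|apply: g_hom => //; exact: additivity_sub].
have c0' : 0 <= - c by rewrite oppr_ge0 ltW.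
have [ANw gNw] := additivityN Aw.
rewrite (_ : c *: w = (- c) *: (- w)); last by rewrite scaleNr scalerN opprK.
split; first exact: additivityZ_ge0.
by rewrite g_hom ?gNw ?mulrNN//; exact: additivity_sub.
Qed.

Lemma additivity_linear_subspace : linear_subspace A.
Proof.
split; first by split; [exact: T_lin.1|move=> h _; rewrite positively_homogeneous0 !addr0].
by move=> a u v /(additivityZ a)[Au _] Av; exact: additivityD.
Qed.

Lemma additivity_linear a u v : A u -> A v -> g (a *: u + v) = a * g u + g v.
Proof.
by move=> /(additivityZ a)[[Tau _] gu] [_ gv]; rewrite gv// gu.
Qed.

Hypothesis T_closed : L2_closed T.
Hypothesis g_cont : forall h (e : R), T h -> 0 < e -> exists2 dl, 0 < dl &
  forall u, T u -> L2norm (u - h) < dl -> `|g u - g h| < e.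

Lemma additivity_closed : L2_closed A.
Proof.
move=> w clw; have Tw : T w.
  by apply: T_closed => e /clw[v /additivity_sub Tv ?]; exists v.
split => // h Th; apply/eqP; rewrite -subr_eq0; apply: contraT => neq.
(* The tolerance is half the additivity defect at [w]: that defect is a difference of two increments
   of [g], each smaller than the tolerance. *)
have e0 : 0 < `|g (h + w) - (g h + g w)| / 2 by rewrite divr_gt0// normr_gt0.
have [d1 d10 h1] := g_cont (linear_subspaceD T_lin Th Tw) e0.
have [d2 d20 h2] := g_cont Tw e0.
have /clw[v Av] : 0 < Num.min d1 d2 by rewrite lt_min d10.
rewrite L2norm_distC lt_min => /andP[wv1 wv2].
have {}h2 := h2 v (additivity_sub Av) wv2.
have {}h1 : `|g (h + v) - g (h + w)| < `|g (h + w) - (g h + g w)| / 2.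
  apply: h1; first by apply: linear_subspaceD => //; exact: additivity_sub.
  by rewrite opprD addrACA subrr add0r.
have := ler_normB (g v - g w) (g (h + v) - g (h + w)).
rewrite (_ : _ - _ = g (h + w) - (g h + g w)); first by lra.
by case: Av => _ ->//; ring.
Qed.

(** Continuity at 0 with tolerance 1 bounds [g] by 1 on vectors of norm [dl / 2]; rescaling gives
    the constant [2 / dl]. *)
Lemma homogeneous_bounded : exists C, forall u, T u -> `|g u| <= C * L2norm u.
Proof.
have [dl dl0 h] := g_cont T_lin.1 ltr01; exists (2 / dl) => u Tu.
have [u0|u0] := eqVneq (L2norm u) 0.
  by rewrite (L2norm_eq0 u0) positively_homogeneous0 normr0 L2norm0 mulr0.
have {}u0 : 0 < L2norm u by rewrite lt_neqAle eq_sym u0 L2norm_ge0.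
pose c := dl / 2 / L2norm u.
have c0 : 0 < c by rewrite !divr_gt0.
have := h (c *: u) (linear_subspaceZ c T_lin Tu).
rewrite subr0 L2normZ gtr0_norm// divfK ?gt_eqF// ltr_pdivrMr// ltr_pMr// ltr1n.
move=> /(_ isT); rewrite positively_homogeneous0 subr0 (g_hom (ltW c0) Tu).
rewrite normrM gtr0_norm//.
rewrite mulrC -ltr_pdivlMr// div1r => /ltW /le_trans; apply.
by rewrite /c !invf_div mulrC.
Qed.

Lemma additivity_representer : exists psi, riesz_representer A g psi.
Proof.
have [C gC] := homogeneous_bounded.
apply: (riesz_representation additivity_linear_subspace additivity_closed
  additivity_linear (C := C)) => u /additivity_sub.
exact: gC.
Qed.

Hypothesis core_additivity : core T g = A.

(* A core element [w] of [g] on the orthocomplement of [A] is a core element on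
   all of [T]: the part along [A] splits off additively. *)
Lemma core_orthocomplement : core (orthocomplement A `&` T) g = [set 0].
Proof.
set Hp := orthocomplement A `&` T.
have Hp_lin : linear_subspace Hp.
  split; first by split; [move=> w _; exact: inner0l|exact: T_lin.1].
  move=> a u v [ou Tu] [ov Tv]; split; last exact: T_lin.2.
  by move=> w Aw; rewrite !innerE ou// ov// mulr0 addr0.
have HpT u : Hp u -> T u by case.
apply/seteqP; split => [w [[Hpw gw] wadd]|_ ->]; last first.
  split; first by split; [exact: Hp_lin.1|rewrite oppr0 positively_homogeneous0 addr0].
  by move=> v c _; rewrite scaler0 addr0 positively_homogeneous0 mulr0 addr0.
(* A vector of [A] that is also orthogonal to [A] is orthogonal to itself. *)
suff Aw : A w by apply: inner_eq0; exact: (proj1 Hpw).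
rewrite -core_additivity; split; first by split => //; exact: HpT.
move=> v c [Tv gv].
have [vk Ak ok] := orthogonal_projection v additivity_linear_subspace additivity_closed.
have [vp Hpvp vE] : exists2 vp, Hp vp & v = vp + vk.
  exists (v - vk); last by rewrite subrK.
  by split => //; apply: linear_subspaceB => //; exact: additivity_sub.
have split_g u : Hp u -> g (u + vk) = g u + g vk by move=> /HpT; exact: (proj2 Ak).
(* [vk] drops out of the antisymmetry of [v] because [g (- vk) = - g vk]. *)
have anti : antisymmetric_part Hp g vp.
  split => //; move: gv; rewrite vE split_g// opprD.
  have [ANk gNk] := additivityN Ak.
  rewrite (proj2 ANk _ (HpT _ (linear_subspaceN Hp_lin Hpvp))) gNk.
  lra.
have Hpcw : Hp (vp + c *: w).
  by apply: linear_subspaceD => //; exact: linear_subspaceZ.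
rewrite vE addrAC (split_g _ Hpcw) (wadd _ _ anti) (split_g _ Hpvp); ring.
Qed.

End AdditivitySpace.

(** Cauchy-Schwarz bounds every ratio by [|psi|^2], and the direction [psi] attains it; for
    [psi = 0] the ratio [0 / 0] is 0, which is still the bound. *)
Lemma information_bound_representer d (X : measurableType d) (R : realType)
    (P : probability X R) (E : set (L2 P)) (g : L2 P -> R) (psi : L2 P) :
  riesz_representer E g psi -> information_bound E g = ((L2norm psi) ^+ 2)%:E.
Proof.
move=> [Epsi gpsi]; apply/eqP; rewrite eq_le; apply/andP; split.
  apply: ge_ereal_sup => _ [h Eh <-]; rewrite lee_fin gpsi//.
  have [h0|h0] := eqVneq (L2norm h) 0.
    by rewrite h0 expr0n invr0 mulr0 sqr_ge0.
  rewrite ler_pdivrMr; last by rewrite exprn_even_gt0.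
  rewrite -exprMn -real_normK ?num_real// lerXn2r ?nnegrE ?mulr_ge0 ?L2norm_ge0//.
  exact: L2_CauchySchwarz.
apply: ereal_sup_ubound; exists psi => //; rewrite gpsi// -sqr_L2norm; congr EFin.
have [->|h0] := eqVneq (L2norm psi) 0; first by rewrite !expr0n mul0r.
by rewrite expr2 mulfK// expf_neq0.
Qed.

(** * Laplace transforms determine measures *)

Section RealSequences.
Context (R : realType).
Implicit Types (x v w : R) (n : nat).

Lemma Bernoulli_le n x : -1 <= x -> 1 + n%:R * x <= (1 + x) ^+ n.
Proof.
move=> x1; elim: n => [|n IH]; first by rewrite mul0r addr0 expr0.
rewrite exprS; apply: le_trans (ler_wpM2l _ IH); last lra.
rewrite -natr1; have := mulr_ge0 (ler0n R n) (sqr_ge0 x); rewrite expr2; lra.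
Qed.

(** By Bernoulli, [(1 - w)^n (1 + n w) <= (1 - w)^n (1 + w)^n = (1 - w^2)^n <= 1]. *)
Lemma expr1B_le n w : 0 <= w <= 1 -> (1 - w) ^+ n <= (1 + n%:R * w)^-1.
Proof.
move=> /andP[w0 w1]; have h := Bernoulli_le n (le_trans (lerN10 R) w0).
have n0 : 0 <= n%:R * w by rewrite mulr_ge0.
rewrite -(ler_pM2r (_ : 0 < 1 + n%:R * w)) ?mulVf; try lra.
apply: (@le_trans _ _ ((1 - w) ^+ n * (1 + w) ^+ n)).
  by rewrite ler_wpM2l// exprn_ge0//; lra.
rewrite -exprMn -[leRHS](expr1n _ n) lerXn2r// ?nnegrE; nra.
Qed.

(** Write [q = s^2]. Bernoulli for [s^-1 = 1 + b] bounds [n s^n] by [b^-1], and the remaining factor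
    [s^n] tends to 0. *)
Lemma cvg_natr_expr (q : R) : 0 <= q < 1 -> (fun n => n%:R * q ^+ n) @ \oo --> (0 : R).
Proof.
move=> /andP[q0 q1]; have [->|qn0] := eqVneq q 0.
  by apply: cvg_near_cst; apply: nearW => -[|n]; rewrite ?mul0r// expr0n mulr0.
have s0 : 0 < Num.sqrt q by rewrite sqrtr_gt0 lt_neqAle eq_sym qn0.
have s1 : Num.sqrt q < 1 by rewrite -sqrtr1 ltr_sqrt.
set s := Num.sqrt q in s0 s1.
have qs : q = s * s by rewrite -expr2 sqr_sqrtr.
pose b := s^-1 - 1.
have b0 : 0 < b by rewrite subr_gt0 invf_gt1.
apply: (@squeeze_cvgr _ _ _ _ (cst 0) (fun n => b^-1 * s ^+ n)); last 2 first.
- exact: cvg_cst.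
- rewrite -[X in _ --> X](mulr0 b^-1); apply: cvgM; first exact: cvg_cst.
  by apply: cvg_expr; rewrite gtr0_norm.
apply: nearW => n; rewrite mulr_ge0 ?exprn_ge0//=.
rewrite qs exprMn mulrA ler_wpM2r ?exprn_ge0 ?(ltW s0)//.
have := Bernoulli_le n (le_trans (lerN10 R) (ltW b0)).
have -> : 1 + b = s^-1 by rewrite /b addrC subrK.
rewrite exprVn => h.
rewrite -(ler_pM2r b0) mulVf ?gt_eqF// mulrAC -ler_pdivlMr ?exprn_gt0// div1r.
by apply: le_trans h; rewrite lerDr.
Qed.

(* Tends to the indicator of [v < 1 / 2] on [0, 1]; the factor [n] in the exponent
   makes the limit vanish at [v = 1 / 2] as well. *)
Definition steep n v : R := (1 - v ^+ n) ^+ (n * 2 ^ n)%N.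

Lemma steep_itv n v : 0 <= v <= 1 -> 0 <= steep n v <= 1.
Proof.
move=> /andP[v0 v1]; have : 0 <= v ^+ n <= 1 by rewrite exprn_ge0// exprn_ile1.
by move=> /andP[? ?]; rewrite /steep exprn_ge0 ?exprn_ile1//; lra.
Qed.

(** The outer exponent times [v ^+ n] is [n (2 v)^n]. If [2 v < 1] this tends to 0 and Bernoulli
    forces the limit 1; otherwise it is at least [n], and [expr1B_le] bounds [steep n v] by
    [1 / (1 + n)]. *)
Lemma cvg_steep v : 0 <= v <= 1 ->
  steep ^~ v @ \oo --> ((v < 2^-1)%R%:R : R).
Proof.
move=> /andP[v0 v1].
have vn n : 0 <= v ^+ n <= 1 by rewrite exprn_ge0// exprn_ile1.
have e n : (n * 2 ^ n)%:R * v ^+ n = n%:R * (2 * v) ^+ n.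
  by rewrite natrM natrX exprMn mulrA.
have [vh|vh] := ltP v 2^-1.
  apply: (@squeeze_cvgr _ _ _ _ (fun n => 1 - n%:R * (2 * v) ^+ n) (cst 1)); last 2 first.
  - rewrite -[X in _ --> X]subr0; apply: cvgB; first exact: cvg_cst.
    by apply: cvg_natr_expr; lra.
  - exact: cvg_cst.
  apply: nearW => n; have /andP[? ->] := steep_itv n (introT andP (conj v0 v1)).
  rewrite andbT -e; have := @Bernoulli_le (n * 2 ^ n) (- v ^+ n).
  by rewrite mulrN; apply; have := vn n; lra.
apply: (@squeeze_cvgr _ _ _ _ (cst 0) (@harmonic R)); last 2 first.
- exact: cvg_cst.
- exact: cvg_harmonic.
apply: nearW => n; have /andP[-> _] /= := steep_itv n (introT andP (conj v0 v1)).
apply: le_trans (expr1B_le _ (vn n)) _; rewrite e /harmonic /=.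
have h : 1 <= (2 * v) ^+ n by rewrite exprn_ege1//; lra.
have n0 : 0 <= n%:R :> R by exact: ler0n.
rewrite lef_pV2 ?posrE ?ltr0n//; last nra.
by rewrite -natr1 addrC lerD2l; nra.
Qed.

Lemma expR_norm_le x : expR `|x| <= expR x + expR (- x).
Proof.
have := expR_ge0 x; have := expR_ge0 (- x).
by case: (ger0P x) => ?; lra.
Qed.

Definition expR_slope n x : R := n.+1%:R * (expR (x / n.+1%:R) - 1).

Lemma expR_slope_itv n x : x <= expR_slope n x <= x * expR (x / n.+1%:R).
Proof.
have n0 : 0 < n.+1%:R :> R by rewrite ltr0n.
rewrite /expR_slope; set y := x / _; have -> : x = n.+1%:R * y.
  by rewrite /y mulrC divfK// gt_eqF.
rewrite -mulrA !ler_pM2l//.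
have := expR_ge1Dx y; have := expR_ge1Dx (- y).
rewrite expRN => h1 h2; apply/andP; split; first lra.
have : (1 - y) * expR y <= 1 by rewrite -ler_pdivlMr ?expR_gt0// div1r.
lra.
Qed.

Lemma cvg_expR_slope x : expR_slope ^~ x @ \oo --> x.
Proof.
apply: (@squeeze_cvgr _ _ _ _ (cst x) (fun n => x * expR (x / n.+1%:R))); last 2 first.
- exact: cvg_cst.
- rewrite -[X in _ --> X]mulr1; apply: cvgM; first exact: cvg_cst.
  rewrite -[X in _ --> X]expR0; apply: continuous_cvg; first exact: continuous_expR.
  rewrite -[X in _ --> X](mulr0 x); apply: cvgM; first exact: cvg_cst.
  exact: cvg_harmonic.
by apply: nearW => n; exact: expR_slope_itv.
Qed.

(** The bound is free of [n] and is a sum of exponentials of multiples of [x], so it can serve as a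
    dominating function whenever such exponentials are integrable. *)
Lemma expR_slope_dom n x : `|expR_slope n x| <= expR (2 * x) + expR (- (2 * x)).
Proof.
apply: (@le_trans _ _ (expR `|2 * x|)); last exact: expR_norm_le.
have /andP[h1 h2] := expR_slope_itv n x.
have x0 : 0 <= `|x| by [].
have e : `|x| * expR `|x| <= expR `|2 * x|.
  rewrite normrM (ger0_norm (ler0n R 2)) mulr_natl mulr2n expRD ler_wpM2r ?expR_ge0//.
  by have := expR_ge1Dx `|x|; lra.
apply: le_trans e; rewrite ler_norml; apply/andP; split.
  apply: le_trans h1; have := ler_norm (- x); rewrite normrN.
  have := expR_ge1Dx `|x|; nra.
apply: le_trans h2 _.
apply: (@le_trans _ _ (`|x| * expR (x / n.+1%:R))).
  by rewrite ler_wpM2r ?expR_ge0 ?ler_norm.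
rewrite ler_wpM2l// ler_expR; apply: le_trans (ler_norm _) _.
rewrite normrM normfV normr_nat.
by rewrite ler_pdivrMr// ler_peMr// ler1n.
Qed.

(** Termwise comparison with the exponential series at [|x|], whose partial sums increase to its
    exponential. *)
Lemma series_sin_coeff_dom n x : `|series (sin_coeff x) n| <= expR `|x|.
Proof.
apply: (@le_trans _ _ (series (exp_coeff `|x|) n)); last first.
  apply: nondecreasing_cvgn_le; last exact: is_cvg_series_exp_coeff.
  by apply: nondecreasing_series => i _ _; exact: exp_coeff_ge0.
rewrite /series /=; apply: le_trans (ler_norm_sum _ _ _) _.
apply: ler_sum => i _; rewrite /sin_coeff /exp_coeff /= !normrM normfV.
rewrite normrX normrX normrN1 expr1n mulr1 (ger0_norm (ler0n _ _)).
rewrite normr_nat ler_wpM2r ?invr_ge0// ler_piMl ?exprn_ge0//.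
by case: (odd i).
Qed.

Lemma cvg_sin_series x : series (sin_coeff x) @ \oo --> sin x.
Proof. by rewrite unlock; exact: is_cvg_series_sin_coeff. Qed.

End RealSequences.

(** * Measures with equal Laplace transforms on a vector space [M] of functions containing the
    constants *)

Section LaplaceDetermines.
Context dY (Y : measurableType dY) (R : realType).
Variables (mu nu : {measure set Y -> \bar R}) (M : set (Y -> R)).
Hypothesis M_cst : forall c, M (cst c).
Hypothesis M_add : forall f g, M f -> M g -> M (fun y => f y + g y).
Hypothesis M_scale : forall c f, M f -> M (fun y => c * f y).
Hypothesis M_meas : forall f, M f -> measurable_fun [set: Y] f.
Hypothesis M_fin : forall f, M f -> (\int[mu]_y (expR (f y))%:E < +oo)%E.
Hypothesis M_eq : forall f, M f ->
  (\int[mu]_y (expR (f y))%:E = \int[nu]_y (expR (f y))%:E)%E.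

Inductive exp_sum : (Y -> R) -> Prop :=
| exp_sum_exp f : M f -> exp_sum (fun y => expR (f y))
| exp_sum_add f g : exp_sum f -> exp_sum g -> exp_sum (fun y => f y + g y).

(* Domination by an [exp_sum] is what makes this class stable under products:
   limits of unbounded functions such as [f] and the Taylor polynomials of
   [sin f] have to be taken in it. *)
Inductive exp_closure : (Y -> R) -> Prop :=
| exp_closure_exp f : M f -> exp_closure (fun y => expR (f y))
| exp_closure_add f g : exp_closure f -> exp_closure g ->
    exp_closure (fun y => f y + g y)
| exp_closure_scale c f : exp_closure f -> exp_closure (fun y => c * f y)
| exp_closure_lim f_ f h : (forall n, exp_closure (f_ n)) -> exp_sum h ->
    (forall n y, `|f_ n y| <= h y) ->
    (forall y, f_ ^~ y @ \oo --> f y) -> exp_closure f.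

(** Integrability under both measures accompanies the equality of integrals because it is what makes
    that equality pass to sums and multiples. *)
Let good (f : Y -> R) := [/\ mu.-integrable setT (EFin \o f),
  nu.-integrable setT (EFin \o f) &
  (\int[mu]_y (f y)%:E = \int[nu]_y (f y)%:E)%E].

Let good_exp f : M f -> good (fun y => expR (f y)).
Proof.
move=> Mf; have mf : measurable_fun setT (EFin \o (fun y => expR (f y))).
  by apply/measurable_EFinP/measurableT_comp => //; exact: M_meas.
split; last exact: M_eq.
- apply/integrableP; split => //.
  by under eq_integral do rewrite gee0_abs ?lee_fin ?expR_ge0//; exact: M_fin.
- apply/integrableP; split => //.
  under eq_integral do rewrite gee0_abs ?lee_fin ?expR_ge0//.
  by rewrite -M_eq//; exact: M_fin.
Qed.

Let good_add f g : good f -> good g -> good (fun y => f y + g y).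
Proof.
move=> [f1 f2 f3] [g1 g2 g3]; split.
- by rewrite (_ : _ \o _ = (EFin \o f) \+ (EFin \o g))%E//; exact: integrableD.
- by rewrite (_ : _ \o _ = (EFin \o f) \+ (EFin \o g))%E//; exact: integrableD.
- by rewrite integralD_EFin// integralD_EFin// f3 g3.
Qed.

Let good_scale c f : good f -> good (fun y => c * f y).
Proof.
move=> [f1 f2 f3]; split.
- exact: (integrableZl measurableT c f1).
- exact: (integrableZl measurableT c f2).
- rewrite (integralZl measurableT f1) (integralZl measurableT f2).
  by rewrite -[X in (_ * X)%E]/(\int[mu]_y (f y)%:E)%E f3.
Qed.

Let good_exp_sum h : exp_sum h -> good h.
Proof. by elim=> [f|f g _ ? _ ?]; [exact: good_exp|exact: good_add]. Qed.

(** Limits are handled by dominated convergence under [mu] and under [nu], the dominating [exp_sum]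
    being integrable for both. *)
Let good_closure f : exp_closure f -> good f.
Proof.
elim=> [{}f|{}f g _ ? _ ?|c {}f _ ?|f_ {}f h _ gf /good_exp_sum [h1 h2 _] fh fc].
- exact: good_exp.
- exact: good_add.
- exact: good_scale.
have mf_ n : measurable_fun setT (EFin \o f_ n).
  by have [/measurable_int] := gf n.
have mf : measurable_fun setT (EFin \o f).
  apply/measurable_EFinP; apply: (@measurable_fun_cvg _ _ _ _ f_) => [n|y _].
    by apply/measurable_EFinP; exact: mf_.
  exact: fc.
have fcE y : setT y -> (EFin \o f_ n) y @[n --> \oo] --> (EFin \o f) y.
  by move=> _; apply: cvg_EFin; [exact: nearW|exact: fc].
have fhE y n : setT y -> (`|(EFin \o f_ n) y| <= (EFin \o h) y)%E.
  by rewrite /= lee_fin => _; exact: fh.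
have [mu1 _ mu2] := dominated_convergence measurableT mf_ mf (aeW mu fcE) h1 (aeW mu fhE).
have [nu1 _ nu2] := dominated_convergence measurableT mf_ mf (aeW nu fcE) h2 (aeW nu fhE).
split => //.
have {}mu2 := cvg_lim (@ereal_hausdorff R) mu2.
have {}nu2 := cvg_lim (@ereal_hausdorff R) nu2.
rewrite -[LHS]mu2 -[RHS]nu2; congr (limn _); apply/funext => n /=.
by have [] := gf n.
Qed.

Lemma exp_sum_mul f g : exp_sum f -> exp_sum g -> exp_sum (fun y => f y * g y).
Proof.
move=> Sf Sg; elim: Sf => [{}f Mf|f1 f2 _ h1 _ h2].
  elim: Sg => [{}g Mg|g1 g2 _ h1 _ h2].
    rewrite (_ : (fun _ => _) = (fun y => expR (f y + g y))).
      exact/exp_sum_exp/M_add.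
    by apply/funext => y; rewrite expRD.
  rewrite (_ : (fun _ => _) = (fun y => expR (f y) * g1 y + expR (f y) * g2 y)).
    exact: exp_sum_add.
  by apply/funext => y; rewrite mulrDr.
rewrite (_ : (fun _ => _) = (fun y => f1 y * g y + f2 y * g y)).
  exact: exp_sum_add.
by apply/funext => y; rewrite mulrDl.
Qed.

Lemma exp_closure_dom f : exp_closure f ->
  exists2 h, exp_sum h & forall y, `|f y| <= h y.
Proof.
elim=> [{}f Mf|{}f g _ [h Sh fh] _ [k Sk gk]|c {}f _ [h Sh fh]|f_ {}f h _ _ Sh fh fc].
- exists (fun y => expR (f y)); first exact: exp_sum_exp.
  by move=> y; rewrite ger0_norm ?expR_ge0.
- exists (fun y => h y + k y); first exact: exp_sum_add.
  by move=> y; apply: le_trans (ler_normD _ _) _; exact: lerD.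
(* [|c|] is replaced by its larger exponential, an [exp_sum] since constants are in [M]; [exp_sum]
   itself has no scaling rule. *)
- exists (fun y => expR `|c| * h y).
    by apply: exp_sum_mul => //; exact: exp_sum_exp (M_cst _).
  move=> y; rewrite normrM ler_pM//.
  by have := expR_ge1Dx `|c|; lra.
- exists h => // y.
  have fn : (fun n => `|f_ n y|) @ \oo --> `|f y| by exact: cvg_norm (fc y).
  rewrite -(cvg_lim (@Rhausdorff R) fn); apply: limr_le.
    by apply/cvg_ex; exists `|f y|.
  by apply: nearW => n; exact: fh.
Qed.

(** Two inductions: first the left factor is a single exponential, then it is arbitrary. At a limit,
    the product of the dominating functions is again an [exp_sum]. *)
Lemma exp_closure_mul f g :
  exp_closure f -> exp_closure g -> exp_closure (fun y => f y * g y).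
Proof.
have mul_exp f' g' : M f' -> exp_closure g' -> exp_closure (fun y => expR (f' y) * g' y).
  move=> Mf; elim=> [{}g' Mg|g1 g2 _ h1 _ h2|c {}g' _ h1|g_ {}g' h _ gf Sh fh fc].
  - rewrite (_ : (fun _ => _) = (fun y => expR (f' y + g' y))).
      exact/exp_closure_exp/M_add.
    by apply/funext => y; rewrite expRD.
  - rewrite (_ : (fun _ => _) = (fun y => expR (f' y) * g1 y + expR (f' y) * g2 y)).
      exact: exp_closure_add.
    by apply/funext => y; rewrite mulrDr.
  - rewrite (_ : (fun _ => _) = (fun y => c * (expR (f' y) * g' y))).
      exact: exp_closure_scale.
    by apply/funext => y; rewrite mulrCA.
  - apply: (exp_closure_lim gf (exp_sum_mul (exp_sum_exp Mf) Sh)).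
      by move=> n y; rewrite normrM (ger0_norm (expR_ge0 _)) ler_wpM2l ?expR_ge0.
    by move=> y; apply: cvgM; [exact: cvg_cst|exact: fc].
move=> Kf Kg; have [k Sk gk] := exp_closure_dom Kg.
elim: Kf => [{}f Mf|f1 f2 _ h1 _ h2|c {}f _ h1|f_ {}f h _ gf Sh fh fc].
- exact: mul_exp.
- rewrite (_ : (fun _ => _) = (fun y => f1 y * g y + f2 y * g y)).
    exact: exp_closure_add.
  by apply/funext => y; rewrite mulrDl.
- rewrite (_ : (fun _ => _) = (fun y => c * (f y * g y))).
    exact: exp_closure_scale.
  by apply/funext => y; rewrite mulrA.
- apply: (exp_closure_lim gf (exp_sum_mul Sh Sk)).
    by move=> n y; rewrite normrM ler_pM.
  by move=> y; apply: cvgM; [exact: fc|exact: cvg_cst].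
Qed.

Lemma exp_sum_cst1 : exp_sum (cst 1).
Proof.
rewrite (_ : cst 1 = (fun y : Y => expR (cst 0 y))); first exact: exp_sum_exp.
by apply/funext => y /=; rewrite expR0.
Qed.

Lemma exp_closure_cst c : exp_closure (cst c).
Proof.
rewrite (_ : cst c = (fun y : Y => c * expR (cst 0 y))).
  exact/exp_closure_scale/exp_closure_exp.
by apply/funext => y /=; rewrite expR0 mulr1.
Qed.

Lemma exp_closure_sub f g :
  exp_closure f -> exp_closure g -> exp_closure (fun y => f y - g y).
Proof.
move=> Kf Kg.
rewrite (_ : (fun _ => _) = (fun y => f y + (-1) * g y)).
  by apply: exp_closure_add => //; exact: exp_closure_scale.
by apply/funext => y; rewrite mulN1r.
Qed.

Lemma exp_closure_exprn f n : exp_closure f -> exp_closure (fun y => f y ^+ n).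
Proof.
move=> Kf; elim: n => [|n IH]; first exact: (exp_closure_cst 1).
rewrite (_ : (fun _ => _) = (fun y => f y * f y ^+ n)); first exact: exp_closure_mul.
by apply/funext => y; rewrite exprS.
Qed.

Lemma exp_closure_sum (f : nat -> Y -> R) n : (forall i, exp_closure (f i)) ->
  exp_closure (fun y => \sum_(0 <= i < n) f i y).
Proof.
move=> Kf; elim: n => [|n IH].
  rewrite (_ : (fun _ => _) = cst 0); first exact: exp_closure_cst.
  by apply/funext => y; rewrite big_geq.
rewrite (_ : (fun _ => _) = (fun y => \sum_(0 <= i < n) f i y + f n y)).
  exact: exp_closure_add.
by apply/funext => y; rewrite big_nat_recr.
Qed.

Lemma exp_closure_linear f : M f -> exp_closure f.
Proof.
move=> Mf; apply: (@exp_closure_lim (fun n y => expR_slope n (f y)) _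
    (fun y => expR (2 * f y) + expR (-1 * (2 * f y)))).
- move=> n; apply: exp_closure_scale; apply: exp_closure_sub; last exact: (exp_closure_cst 1).
  rewrite (_ : (fun _ => _) = (fun y => expR (n.+1%:R^-1 * f y))).
    exact/exp_closure_exp/M_scale.
  by apply/funext => y; rewrite mulrC.
- by apply: exp_sum_add; apply: exp_sum_exp; do ?apply: M_scale.
- by move=> n y; rewrite mulN1r; exact: expR_slope_dom.
- by move=> y; exact: cvg_expR_slope.
Qed.

Lemma exp_closure_sin f : M f -> exp_closure (fun y => sin (f y)).
Proof.
move=> Mf; apply: (@exp_closure_lim (fun n y => series (sin_coeff (f y)) n) _
    (fun y => expR (f y) + expR (-1 * f y))).
- move=> n; apply: exp_closure_sum => i.
  rewrite (_ : (fun _ => _) = (fun y => sin_coeff 1 i * f y ^+ i)).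
    exact/exp_closure_scale/exp_closure_exprn/exp_closure_linear.
  by apply/funext => y; rewrite /sin_coeff /= expr1n; ring.
- by apply: exp_sum_add; apply: exp_sum_exp => //; exact: M_scale.
- move=> n y; rewrite mulN1r.
  exact: le_trans (series_sin_coeff_dom _ _) (expR_norm_le _).
- by move=> y; exact: cvg_sin_series.
Qed.

(** [(1 + sin f) / 2] lies in [0, 1] and is below 1/2 exactly when [sin f < 0], so [steep] of it
    tends to the indicator. *)
Lemma exp_closure_sin_lt0 f : M f -> exp_closure (fun y => (sin (f y) < 0)%R%:R).
Proof.
move=> Mf; have v01 y : 0 <= 2^-1 * (1 + sin (f y)) <= 1.
  by have := sin_le1 (f y); have := sin_geN1 (f y); lra.
apply: (@exp_closure_lim (fun n y => steep n (2^-1 * (1 + sin (f y)))) _ (cst 1)).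
- move=> n; rewrite /steep; apply: exp_closure_exprn.
  apply: exp_closure_sub; first exact: (exp_closure_cst 1).
  apply/exp_closure_exprn/exp_closure_scale/exp_closure_add.
    exact: (exp_closure_cst 1).
  exact: exp_closure_sin.
- exact: exp_sum_cst1.
- by move=> n y; have /andP[? ?] := steep_itv n (v01 y); rewrite ger0_norm.
- move=> y; rewrite (_ : (sin (f y) < 0) = (2^-1 * (1 + sin (f y)) < 2^-1)).
    exact: cvg_steep.
  by apply/idP/idP; lra.
Qed.

(** For large [n] the value [f y / (n + 1)] lies between -pi and pi, where the sine has the sign of
    its argument. *)
Lemma exp_closure_lt0 f : M f -> exp_closure (fun y => (f y < 0)%R%:R).
Proof.
move=> Mf.
apply: (@exp_closure_lim (fun n y => (sin (n.+1%:R^-1 * f y) < 0)%R%:R) _ (cst 1)).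
- by move=> n; exact/exp_closure_sin_lt0/M_scale.
- exact: exp_sum_cst1.
- by move=> n y; rewrite normr_nat; case: (_ < _).
- move=> y; apply: cvg_near_cst.
  have pi0 := @pi_gt0 R.
  have : \forall n \near \oo, n.+1%:R^-1 * `|f y| < pi.
    have : (fun n => n.+1%:R^-1 * `|f y|) @ \oo --> (0 : R).
      rewrite -[X in _ --> X](mul0r `|f y|); apply: cvgM; last exact: cvg_cst.
      exact: cvg_harmonic.
    by move/cvgr_lt; apply.
  apply: filterS => n; set e := n.+1%:R^-1 => h; congr (nat_of_bool _)%:R.
  have e0 : 0 < e by rewrite invr_gt0 ltr0n.
  have [f0|f0|->] := ltrgt0P (f y).
  + have : 0 < sin (e * f y).
      by apply: sin_gt0_pi; rewrite mulr_gt0//= -(gtr0_norm f0).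
    by move=> /ltW; rewrite leNgt => /negbTE.
  + have : 0 < sin (- (e * f y)).
      apply: sin_gt0_pi; rewrite oppr_gt0 pmulr_rlt0// f0/= -mulrN.
      by rewrite -(ltr0_norm f0).
    by rewrite sinN oppr_gt0 => ->.
  + by rewrite mulr0 sin0 ltxx.
Qed.

Let determined : set (set Y) := [set A | exp_closure (\1_A)].

Let determinedI A B : determined A -> determined B -> determined (A `&` B).
Proof. by rewrite /determined/= indicI; exact: exp_closure_mul. Qed.

Let determinedC A : determined A -> determined (~` A).
Proof.
rewrite /determined/= => KA; rewrite (_ : \1_(~` A) = (fun y => cst 1 y - \1_A y)).
  by apply: exp_closure_sub => //; exact: exp_closure_cst.
by apply/funext => y; rewrite /= !indicE in_setC; case: (y \in A); rewrite ?subrr ?subr0.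
Qed.

(** Intersections are products and complements are differences from 1; a countable union is a limit
    of finite unions, eventually constant at each point. *)
Let determined_sigma : sigma_algebra setT determined.
Proof.
have d0 : determined set0 by rewrite /determined/= indic0; exact: exp_closure_cst.
split=> // [A|A dA]; first by rewrite setTD; exact: determinedC.
have dU n : determined (\big[setU/set0]_(i < n) A i).
  elim: n => [|n IH]; first by rewrite big_ord0.
  rewrite big_ord_recr/= -[X in determined X]setCK setCU.
  by apply: determinedC; apply: determinedI; exact: determinedC.
apply: (exp_closure_lim dU exp_sum_cst1).
  by move=> n y; rewrite /= indicE normr_nat; case: (_ \in _).
move=> y; apply: cvg_near_cst; rewrite !indicE.
have [[n _ An]|yA] := pselect ((\bigcup_k A k) y).
  exists n.+1 => // m /= nm; rewrite !indicE !mem_set//; first by exists n.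
  by rewrite -bigcup_mkord; exists n.
apply: nearW => n; rewrite indicE !memNset// => h; apply: yA.
by move: h; rewrite -bigcup_mkord => -[k _ Ak]; exists k.
Qed.

Let determined_preimage f B : M f -> measurable B -> determined (f @^-1` B).
Proof.
move=> Mf mB; have {mB} : <<s @RGenInftyO.G R >> B.
  by have := @RGenInftyO.measurableE R; rewrite /measurable/= => <-.
move: B.
suff h : sigma_algebra setT [set B | determined (f @^-1` B)].
  (* Open rays generate the Borel sets, and the preimage of the ray below [a] is where [f - a],
     again in [M], is negative. *)
  apply: smallest_sub h _ => _ [a ->].
  rewrite /determined/= (_ : \1__ = (fun y => (f y + cst (- a) y < 0)%R%:R)).
    exact/exp_closure_lt0/M_add.
  apply/funext => y; rewrite indicE /= subr_lt0; congr (nat_of_bool _)%:R.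
  by apply/idP/idP => [/set_mem|h]; [|apply/mem_set]; rewrite /= in_itv.
have [h1 h2 h3] := determined_sigma; split => [|A|A].
- by rewrite /= preimage_set0.
- by move/h2.
- by move/h3; rewrite /= preimage_bigcup.
Qed.

Lemma laplace_determines :
  (forall S, sigma_algebra setT S ->
    (forall f B, M f -> measurable B -> S (f @^-1` B)) -> measurable `<=` S) ->
  forall A, measurable A -> mu A = nu A.
Proof.
move=> gen A mA.
have /good_closure[_ _] : exp_closure (\1_A).
  exact: (gen _ determined_sigma determined_preimage A mA).
by rewrite !integral_indic// !setIT.
Qed.

End LaplaceDetermines.

(** * Gaussian-shift experiments *)

Section NormalMgf.
Context dO (Omega : measurableType dO) (R : realType).
Local Notation leb := (@lebesgue_measure R).

Lemma ge0_integral_law dY (Y : measurableType dY) (Q : {measure set Omega -> \bar R})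
    (m : {measure set Y -> \bar R}) (phi : Omega -> Y) (f : Y -> \bar R) :
  measurable_fun setT phi ->
  (forall A, measurable A -> m A = Q (phi @^-1` A)) ->
  measurable_fun setT f -> (forall y, 0 <= f y)%E ->
  (\int[m]_y f y = \int[Q]_w f (phi w))%E.
Proof.
move=> mphi mQ mf f0.
pose mphi' : phi \in mfun := mem_set mphi.
rewrite (@eq_measure_integral _ _ _ _ (pushforward Q (mfun_Sub mphi'))); last first.
  by move=> A mA _; exact: mQ.
by rewrite ge0_integral_pushforward.
Qed.

(** [normal_pdf] and the Radon-Nikodym derivative have equal integrals over every measurable set, so
    they agree almost everywhere. *)
Lemma ge0_integral_normal_prob (m s : R) (f : R -> \bar R) :
  measurable_fun setT f -> (forall x, 0 <= f x)%E ->
  (\int[normal_prob m s]_x f x = \int[leb]_x (f x * (normal_pdf m s x)%:E))%E.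
Proof.
move=> mf f0; have dom := normal_prob_dominates m s.
rewrite -(Radon_Nikodym_SigmaFinite.change_of_variables dom)//.
have iRN := Radon_Nikodym_SigmaFinite.f_integrable dom.
have mpdf : measurable_fun setT (fun x => (normal_pdf m s x)%:E).
  by apply/measurable_EFinP; exact: measurable_normal_pdf.
apply: ae_eq_integral => //.
- by apply: emeasurable_funM => //; exact: measurable_int iRN.
- exact: emeasurable_funM.
- apply: ae_eqe_mul2l; apply: integral_ae_eq => // A _ mA.
  by rewrite -Radon_Nikodym_SigmaFinite.f_integral.
Qed.

(** Completing the square: tilting by [expR (a * x)] moves the mean from 0 to [a * s ^+ 2]. *)
Lemma normal_pdf_tilt (a s x : R) : s != 0 ->
  expR (a * x) * normal_pdf 0 s x =
  expR (a ^+ 2 * s ^+ 2 / 2) * normal_pdf (a * s ^+ 2) s x.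
Proof.
move=> s0; rewrite !normal_pdfE// /normal_fun mulrCA [RHS]mulrCA; congr (_ * _).
by rewrite -!expRD; congr expR; field.
Qed.

Lemma mgf_normal_prob (a s : R) : s != 0 ->
  (\int[normal_prob 0 s]_x (expR (a * x))%:E = (expR (a ^+ 2 * s ^+ 2 / 2))%:E)%E.
Proof.
move=> s0; rewrite ge0_integral_normal_prob; last 2 first.
- by apply/measurable_EFinP; apply: measurableT_comp => //; exact: measurable_funM.
- by move=> x; rewrite lee_fin expR_ge0.
under eq_integral do rewrite -EFinM normal_pdf_tilt// EFinM.
by rewrite integralZl// ?integral_normal_pdf ?mule1//; exact: integrable_normal_pdf.
Qed.

Lemma mgf_normal_law (Q : probability Omega R) (L : Omega -> R) (s : R) :
  measurable_fun setT L ->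
  (forall A, measurable A -> Q [set w | A (L w)] = normal_law 0 s A) ->
  forall a, (\int[Q]_w (expR (a * L w))%:E = (expR (a ^+ 2 * s ^+ 2 / 2))%:E)%E.
Proof.
move=> mL QL a; have mexp : measurable_fun setT (fun x : R => (expR (a * x))%:E).
  by apply/measurable_EFinP; apply: measurableT_comp => //; exact: measurable_funM.
have exp0 x : (0 <= (expR (a * x))%:E)%E by rewrite lee_fin expR_ge0.
have [s0|s0] := eqVneq s 0.
  rewrite -(@ge0_integral_law _ _ _ (\d_(0 : R)) _ (fun x => (expR (a * x))%:E) mL)//.
    by rewrite integral_dirac// diracT mul1e mulr0 s0 expr0n mulr0 mul0r.
  by move=> A mA; have := QL A mA; rewrite /normal_law s0 eqxx => /esym.
rewrite -(@ge0_integral_law _ _ _ (normal_prob 0 s) _ (fun x => (expR (a * x))%:E) mL)//.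
  exact: mgf_normal_prob.
by move=> A mA; have := QL A mA; rewrite /normal_law (negbTE s0) => /esym.
Qed.

(** * Mean and variance from the moment generating function *)

Section Moments.
Variables (Q : probability Omega R) (L : Omega -> R) (s : R).
Hypothesis mL : measurable_fun setT L.
Hypothesis mgf : forall a,
  (\int[Q]_w (expR (a * L w))%:E = (expR (a ^+ 2 * s ^+ 2 / 2))%:E)%E.

Let mexp a : measurable_fun setT (fun w => (expR (a * L w))%:E).
Proof.
by apply/measurable_EFinP; apply: measurableT_comp => //; exact: measurable_funM.
Qed.

Let iexp a : Q.-integrable setT (fun w => (expR (a * L w))%:E).
Proof.
apply/integrableP; split => //.
by under eq_integral do rewrite gee0_abs ?lee_fin ?expR_ge0//; rewrite mgf ltry.
Qed.

Let slopeE n w : expR_slope n (L w) = n.+1%:R * (expR (n.+1%:R^-1 * L w) - 1).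
Proof. by rewrite /expR_slope mulrC (mulrC (L w)) mulrC. Qed.

Let int_slope n : (\int[Q]_w (expR_slope n (L w))%:E =
  (n.+1%:R * (expR (n.+1%:R^-1 ^+ 2 * s ^+ 2 / 2) - 1))%:E)%E.
Proof.
have i1 : Q.-integrable setT (fun=> 1%:E) by exact: finite_measure_integrable_cst.
under eq_integral do rewrite slopeE EFinM EFinB.
rewrite integralZl//; last exact: integrableB (iexp _) i1.
rewrite integralB//.
by rewrite mgf integral_cst//= probability_setT mule1.
Qed.

Let int_slope_sqr n : (\int[Q]_w (expR_slope n (L w) ^+ 2)%:E =
  (n.+1%:R ^+ 2 * (expR (n.+1%:R^-1 ^+ 2 * (2 * s ^+ 2)) -
     2 * expR (n.+1%:R^-1 ^+ 2 * (s ^+ 2 / 2)) + 1))%:E)%E.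
Proof.
have i1 : Q.-integrable setT (fun=> 1%:E) by exact: finite_measure_integrable_cst.
have e w : (expR_slope n (L w) ^+ 2)%:E =
    ((n.+1%:R ^+ 2)%:E * ((expR (2 * n.+1%:R^-1 * L w))%:E -
      2%:E * (expR (n.+1%:R^-1 * L w))%:E + 1%:E))%E.
  rewrite -EFinM slopeE exprMn; congr (_ * _)%:E.
  by rewrite -mulrA mulr_natl mulr2n expRD; ring.
under eq_integral do rewrite e.
have i2 := integrableB measurableT (iexp (2 * n.+1%:R^-1))
   (integrableZl measurableT 2 (iexp n.+1%:R^-1)).
rewrite integralZl//; last exact: integrableD i2 i1.
rewrite integralD// integralB//.
rewrite (integralZl measurableT (iexp n.+1%:R^-1)).
rewrite !mgf integral_cst//= probability_setT mule1.
rewrite -EFinM; congr (_ * (expR _ - 2 * expR _ + _))%:E.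
- by rewrite exprMn; field; rewrite addrC natr1 pnatr_eq0.
- by rewrite -mulrA.
- exact: (integrableZl measurableT 2 (iexp _)).
Qed.

(** The sequence is [expR_slope] at [c] along the indices [(n + 1)^2 - 1]. *)
Let cvg_slope_sqr (c : R) :
  (fun n : nat => n.+1%:R ^+ 2 * (expR (n.+1%:R^-1 ^+ 2 * c) - 1) : R) @ \oo --> c.
Proof.
have k : (fun n : nat => (n.+1 ^ 2).-1)%N @ \oo --> \oo.
  apply/cvgnyPge => N; near=> n.
  apply: (@leq_trans n); first by near: n; exact: nbhs_infty_ge.
  by rewrite -ltnS prednK ?expn_gt0// expnS expn1 leq_pmulr.
have h := cvg_comp _ _ k (@cvg_expR_slope R c).
have e n : expR_slope (n.+1 ^ 2)%N.-1 c = n.+1%:R ^+ 2 * (expR (n.+1%:R^-1 ^+ 2 * c) - 1).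
  by rewrite /expR_slope prednK ?expn_gt0// natrX exprVn (mulrC _ c).
by under eq_fun do rewrite -e.
Unshelve. all: end_near.
Qed.

Let dom1 n w : (`|(expR_slope n (L w))%:E| <=
  (expR (2 * L w))%:E + (expR (- 2 * L w))%:E)%E.
Proof. by rewrite /= -EFinD lee_fin mulNr; exact: expR_slope_dom. Qed.

Let dom2 n w : (`|(expR_slope n (L w) ^+ 2)%:E| <=
  (expR (4 * L w))%:E + (expR (- 4 * L w))%:E + 2%:E)%E.
Proof.
rewrite /= -!EFinD lee_fin normrX.
apply: (@le_trans _ _ ((expR (2 * L w) + expR (- (2 * L w))) ^+ 2)).
  by rewrite lerXn2r// ?nnegrE ?addr_ge0 ?expR_ge0//; exact: expR_slope_dom.
rewrite sqrrD -expRD subrr expR0 !expr2 -!expRD.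
rewrite (_ : 2 * L w + 2 * L w = 4 * L w); last ring.
rewrite (_ : - (2 * L w) + - (2 * L w) = - 4 * L w); last ring.
by rewrite mulr2n; lra.
Qed.

Let mslope n : measurable_fun setT (fun w => expR_slope n (L w)).
Proof.
apply: measurable_funM => //; apply: measurable_funB => //.
by apply: measurableT_comp => //; exact: measurable_funM.
Qed.

Let slope_sqr_dominated : Q.-integrable setT (fun w => (L w ^+ 2)%:E) /\
  (fun n => (\int[Q]_w (expR_slope n (L w) ^+ 2)%:E)%E) @ \oo -->
    (\int[Q]_w (L w ^+ 2)%:E)%E.
Proof.
have i1 : Q.-integrable setT (fun=> 2%:E) by exact: finite_measure_integrable_cst.
have [] := @dominated_convergence _ _ _ Q setT measurableT
  (fun n w => (expR_slope n (L w) ^+ 2)%:E) (fun w => (L w ^+ 2)%:E)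
  (fun w => (expR (4 * L w))%:E + (expR (- 4 * L w))%:E + 2%:E)%E => //.
- by move=> n; apply/measurable_EFinP/measurable_funX.
- exact/measurable_EFinP/measurable_funX.
- apply: aeW => w _; apply: cvg_EFin; first exact: nearW.
  exact: (cvg_comp _ _ (@cvg_expR_slope R (L w)) (@sqr_continuous R (L w))).
- by apply: integrableD => //; exact: integrableD.
- by apply: aeW => w n _; exact: dom2.
Qed.

Lemma Lfun2_mgf : L \in Lfun Q 2%:E.
Proof.
apply: sqr_integrable_Lfun => //.
have [/integrableP[_ +] _] := slope_sqr_dominated.
by under eq_integral do rewrite gee0_abs ?lee_fin ?sqr_ge0//.
Qed.

(** The second moments of the slopes combine [cvg_slope_sqr] at [2 * s ^+ 2] with weight 1 and at
    [s ^+ 2 / 2] with weight -2, so they tend to [2 s^2 - s^2]. *)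
Lemma expectation_sqr_mgf : (\int[Q]_w (L w ^+ 2)%:E = (s ^+ 2)%:E)%E.
Proof.
have [_ /(cvg_lim (@ereal_hausdorff R)) <-] := slope_sqr_dominated.
apply/cvg_lim => //=; under eq_fun do rewrite int_slope_sqr.
apply: cvg_EFin; first exact: nearW.
rewrite /comp/= [X in _ --> X](_ : _ = 2 * s ^+ 2 - 2 * (s ^+ 2 / 2)); last by field.
have e n : n.+1%:R ^+ 2 * (expR (n.+1%:R^-1 ^+ 2 * (2 * s ^+ 2)) -
      2 * expR (n.+1%:R^-1 ^+ 2 * (s ^+ 2 / 2)) + 1) =
    n.+1%:R ^+ 2 * (expR (n.+1%:R^-1 ^+ 2 * (2 * s ^+ 2)) - 1) -
    2 * (n.+1%:R ^+ 2 * (expR (n.+1%:R^-1 ^+ 2 * (s ^+ 2 / 2)) - 1)) by ring.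
under eq_fun do rewrite e.
apply: cvgB; first exact: cvg_slope_sqr.
by apply: cvgM; [exact: cvg_cst|exact: cvg_slope_sqr].
Qed.

(** The mean of the slope is [1 / (n + 1)] times a convergent sequence. *)
Lemma expectation_mgf : (\int[Q]_w (L w)%:E = 0)%E.
Proof.
have [] := @dominated_convergence _ _ _ Q setT measurableT
  (fun n w => (expR_slope n (L w))%:E) (fun w => (L w)%:E)
  (fun w => (expR (2 * L w))%:E + (expR (- 2 * L w))%:E)%E.
- by move=> n; apply/measurable_EFinP.
- exact/measurable_EFinP.
- apply: aeW => w _; apply: cvg_EFin; first exact: nearW.
  exact: cvg_expR_slope.
- exact: integrableD.
- by apply: aeW => w n _; exact: dom1.
move=> _ _ /(cvg_lim (@ereal_hausdorff R)) <-; apply/cvg_lim => //=.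
under eq_fun do rewrite int_slope.
apply: cvg_EFin; first exact: nearW.
rewrite /comp/= [X in _ --> X](_ : _ = 0 * (s ^+ 2 / 2)); last by rewrite mul0r.
have e n : n.+1%:R * (expR (n.+1%:R^-1 ^+ 2 * s ^+ 2 / 2) - 1) =
    n.+1%:R^-1 * (n.+1%:R ^+ 2 * (expR (n.+1%:R^-1 ^+ 2 * (s ^+ 2 / 2)) - 1)).
  rewrite -(mulrA (n.+1%:R^-1 ^+ 2)); set x := expR _.
  by rewrite mulrA (expr2 n.+1%:R) mulrA mulVf ?pnatr_eq0// mul1r.
under eq_fun do rewrite e.
by apply: cvgM; [exact: cvg_harmonic|exact: cvg_slope_sqr].
Qed.

Lemma variance_mgf : variance Q L = (s ^+ 2)%:E.
Proof.
rewrite varianceE ?Lfun2_mgf// unlock expectation_mgf.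
by rewrite -[RHS]expectation_sqr_mgf expe2 mule0 sube0.
Qed.

End Moments.
End NormalMgf.

Section LinearCombinations.
Context (R : realType).

(** With lists of weighted indices, sums of combinations are concatenations, and a change of index
    set is a [map]. *)
Definition lincomb (I : Type) (x : I -> R) (s : seq (R * I)) : R :=
  \sum_(p <- s) p.1 * x p.2.

Lemma lincomb_cat (I : Type) (x : I -> R) s1 s2 :
  lincomb x (s1 ++ s2) = lincomb x s1 + lincomb x s2.
Proof. exact: big_cat. Qed.

Lemma lincomb_map (I J : Type) (f : J -> I) (x : I -> R) (s : seq (R * J)) :
  lincomb x [seq (p.1, f p.2) | p <- s] = lincomb (x \o f) s.
Proof. by rewrite /lincomb big_map. Qed.

Lemma lincomb_scale (I : Type) (x : I -> R) c (s : seq (R * I)) :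
  lincomb x [seq (c * p.1, p.2) | p <- s] = c * lincomb x s.
Proof.
by rewrite /lincomb big_map mulr_sumr; apply: eq_bigr => p _; rewrite mulrA.
Qed.

Lemma lincombD (I : Type) (x y : I -> R) (s : seq (R * I)) :
  lincomb (fun i => x i + y i) s = lincomb x s + lincomb y s.
Proof.
by rewrite /lincomb -big_split; apply: eq_bigr => p _; rewrite mulrDr.
Qed.

Lemma measurable_lincomb dO (Omega : measurableType dO) (I : Type)
    (x : I -> Omega -> R) s : (forall i, measurable_fun setT (x i)) ->
  measurable_fun [set: Omega] (fun w => lincomb (x^~ w) s).
Proof. by move=> mx; apply: measurable_sum => p; apply: measurable_funM. Qed.

End LinearCombinations.

(** * Moment generating function of an isonormal process *)

Section Isonormal.
Context d (X : measurableType d) (R : realType) (P : probability X R).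
Variable E : set (L2 P).

Definition L2comb (s : seq (R * E)) : L2 P := \sum_(p <- s) p.1 *: val p.2.

Lemma inner_L2comb s (u : L2 P) : inner u (L2comb s) = lincomb (fun g => inner u (val g)) s.
Proof.
rewrite /L2comb /lincomb; elim: s => [|p s IH]; first by rewrite !big_nil inner0r.
by rewrite !big_cons innerDr innerZr IH.
Qed.

Context dO (Omega : measurableType dO) (Q : probability Omega R).
Variable Delta : E -> Omega -> R.
Hypothesis isoD : isonormal Q Delta.

Let mD g : measurable_fun setT (Delta g).
Proof. by case: isoD. Qed.

Let XX s w := lincomb (Delta ^~ w) s.

Let law s : exists r : R, forall a,
  (\int[Q]_w (expR (a * XX s w))%:E = (expR (a ^+ 2 * r ^+ 2 / 2))%:E)%E.
Proof.
have [_ h _] := isoD.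
have [r hr] := h (size s) (fun i => (tnth (in_tuple s) i).1)
  (fun i => (tnth (in_tuple s) i).2).
exists r; apply: mgf_normal_law; first exact: measurable_lincomb.
move=> A mA; rewrite -hr//; congr (Q _); apply/funext => w /=.
by rewrite /XX /lincomb (big_tnth _ _ s).
Qed.

Let L2D g : Delta g \in Lfun Q 2%:E.
Proof.
have [r hr] := law [:: (1, g)].
rewrite (_ : Delta g = XX [:: (1, g)]).
  by apply: Lfun2_mgf hr; exact: measurable_lincomb.
by apply/funext => w; rewrite /XX /lincomb big_seq1 mul1r.
Qed.

Let L2X s : XX s \in Lfun Q 2%:E.
Proof. by have [r hr] := law s; apply: Lfun2_mgf hr; exact: measurable_lincomb. Qed.

Let covX (Z : Omega -> R) (z : L2 P) s : Z \in Lfun Q 2%:E ->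
  (forall g, covariance Q (Delta g) Z = (inner (val g) z)%:E) ->
  covariance Q (XX s) Z = (inner (L2comb s) z)%:E.
Proof.
have L21 (f : Omega -> R) : f \in Lfun Q 2%:E -> f \in Lfun Q 1.
  by apply: Lfun_subset12; exact: fin_num_measure.
move=> LZ hZ; elim: s => [|p s IH].
  rewrite /XX (_ : (fun w => _) = cst 0); last first.
    by apply/funext => w; rewrite /lincomb big_nil.
  by rewrite covariance_cst_l /L2comb big_nil inner0l.
have -> : XX (p :: s) = (p.1 \o* Delta p.2 \+ XX s)%R.
  by apply/funext => w; rewrite /XX /lincomb big_cons /= mulrC.
rewrite covarianceDl//; last first.
  by apply: Lfun_scale => //; lra.
rewrite covarianceZl; [|exact: L21|exact: L21|exact: (Lfun2_mul_Lfun1 (L2D _) LZ)].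
rewrite hZ IH.
by rewrite /L2comb big_cons innerDl innerZl.
Qed.

(** The combination is centred normal with an unspecified parameter [r]. Its variance [r ^+ 2] is
    [inner (L2comb s) (L2comb s)] by bilinearity of the covariance, with [covX] used in each
    argument; this fixes the transform at [a = 1]. *)
Lemma isonormal_mgf s :
  (\int[Q]_w (expR (lincomb (Delta ^~ w) s))%:E =
   (expR (inner (L2comb s) (L2comb s) / 2))%:E)%E.
Proof.
have [r hr] := law s; have [_ _ hcov] := isoD.
have mX : measurable_fun setT (XX s) by exact: measurable_lincomb.
have := variance_mgf mX hr; rewrite /variance.
rewrite (@covX _ (L2comb s))//; last first.
  move=> g; rewrite covarianceC innerC; exact: covX.
move=> [->]; have := hr 1; rewrite expr1n mul1r => <-.
by apply: eq_integral => w _; rewrite mul1r.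
Qed.

End Isonormal.

(** * Laplace transforms of the shifted laws on path space *)

Section GaussianShift.
Context d (X : measurableType d) (R : realType) (P : probability X R).
Variable E : set (L2 P).

Lemma measurable_eval (g : E) : measurable_fun [set: paths E] (fun x : paths E => x g).
Proof.
move=> _ B mB; apply: sub_sigma_algebra; exists g => //.
by exists B.
Qed.

Lemma measurable_lincomb_path (s : seq (R * E)) :
  measurable_fun [set: paths E] (fun x => lincomb x s).
Proof.
exact: (measurable_lincomb (x := fun g (x : paths E) => x g) s measurable_eval).
Qed.

Lemma measurable_to_paths dO (Omega : measurableType dO) (phi : Omega -> paths E) :
  (forall g : E, measurable_fun setT (fun w => phi w g)) -> measurable_fun setT phi.
Proof.
move=> mphi; apply: (@measurability _ _ _ (paths E) _ _ (@cylinders _ _ _ P E)) => //.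
move=> _ [_ [g _] [B mB <-]] <-.
by rewrite setTI; have := mphi g measurableT B mB.
Qed.

(** Under [h] each coordinate [g] is shifted by [inner h g], so the combination is shifted by the
    constant [inner h (L2comb s)], whose exponential leaves the integral. *)
Lemma gaussian_shift_mgf (Q : E -> probability (paths E) R) :
  gaussian_shift_experiment Q -> forall h s,
  (\int[Q h]_x (expR (lincomb x s))%:E =
   (expR (inner (val h) (L2comb s) + inner (L2comb s) (L2comb s) / 2))%:E)%E.
Proof.
case=> dO0 [Om [Pr [Delta [iso hQ]]]] h s; have [mD _ _] := iso.
pose phi (w : Om) : paths E := fun g => Delta g w + inner (val h) (val g).
have mphi : measurable_fun setT phi.
  by apply: measurable_to_paths => g; apply: measurable_funD.
rewrite (@ge0_integral_law _ _ _ _ _ Pr _ phi)//; last first.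
- by apply/measurable_EFinP/measurableT_comp => //; exact: measurable_lincomb_path.
- exact: hQ.
transitivity (\int[Pr]_w ((expR (inner (val h) (L2comb s)))%:E *
    (expR (lincomb (Delta ^~ w) s))%:E))%E.
  apply: eq_integral => w _; rewrite -EFinM -expRD inner_L2comb; congr (expR _)%:E.
  by rewrite /phi lincombD addrC.
rewrite ge0_integralZl//; first by rewrite (isonormal_mgf iso) -EFinM -expRD.
by apply/measurable_EFinP/measurableT_comp => //; exact: measurable_lincomb.
Qed.

End GaussianShift.

(** * Product decomposition of the experiment along orthogonal subspaces *)

Section GaussianShiftProduct.
Context d (X : measurableType d) (R : realType) (P : probability X R).

(** The sets whose preimage lies in [S] form a sigma-algebra, and it contains the cylinders
    generating [paths E]. *)
Lemma sigma_algebra_paths (E : set (L2 P)) (Y : Type) (phi : Y -> paths E)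
    (S : set (set Y)) : sigma_algebra setT S ->
  (forall (g : E) (B : set R), measurable B -> S ((fun y => phi y g) @^-1` B)) ->
  forall B, measurable B -> S (phi @^-1` B).
Proof.
move=> [S0 SC SU] Sev.
have h : sigma_algebra setT [set B | S (phi @^-1` B)].
  split=> [|A|A]; first by rewrite /= preimage_set0.
  - by move/SC.
  - by move/SU; rewrite /= preimage_bigcup.
apply: smallest_sub h _ => _ [g _ [B mB <-]].
by rewrite setTI; exact: Sev.
Qed.

(** The constant is there because [laplace_determines] asks for a class containing the constants; it
    also absorbs the other coordinate in iterated integrals. *)
Lemma gaussian_shift_mgf_affine (E : set (L2 P)) (Q : E -> probability (paths E) R) :
  gaussian_shift_experiment Q -> forall h s c,
  (\int[Q h]_x (expR (lincomb x s + c))%:E =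
   (expR (inner (val h) (L2comb s) + inner (L2comb s) (L2comb s) / 2 + c))%:E)%E.
Proof.
move=> sQ h s c.
under eq_integral do rewrite expRD EFinM.
rewrite ge0_integralZr//; first by rewrite (gaussian_shift_mgf sQ) -EFinM -expRD.
  by apply/measurable_EFinP/measurableT_comp => //; exact: measurable_lincomb_path.
Qed.

Variables (E F G : set (L2 P)) (FE : F `<=` E) (GE : G `<=` E).
Variables (k : E -> F) (p : E -> G).
Hypothesis split_kp : forall (h : E) (f : F) (g : G),
  val h = val f + val g <-> f = k h /\ g = p h.
Hypothesis FG : forall (f : F) (g : G), inner (val f) (val g) = 0.

Let val_kp h : val h = val (k h) + val (p h).
Proof. exact/split_kp. Qed.

Let m_affine s t c : measurable_fun setT
  (fun y : paths F * paths G => lincomb y.1 s + lincomb y.2 t + c).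
Proof.
apply: measurable_funD => //; apply: measurable_funD.
  by apply: (measurableT_comp (measurable_lincomb_path s)); exact: measurable_fst.
by apply: (measurableT_comp (measurable_lincomb_path t)); exact: measurable_snd.
Qed.

Let lincomb0 (I : Type) (x : I -> R) s : (forall i, x i = 0) -> lincomb x s = 0.
Proof.
by move=> x0; rewrite /lincomb big1// => i _; rewrite x0 mulr0.
Qed.

Let orthF (f : F) (s : seq (R * G)) : inner (val f) (L2comb s) = 0.
Proof. by rewrite inner_L2comb lincomb0. Qed.

Let orthG (g : G) (s : seq (R * F)) : inner (val g) (L2comb s) = 0.
Proof. by rewrite inner_L2comb lincomb0// => f; rewrite innerC. Qed.

Let orthFG (s : seq (R * F)) (t : seq (R * G)) : inner (L2comb s) (L2comb t) = 0.
Proof. by rewrite innerC inner_L2comb lincomb0// => f; rewrite innerC. Qed.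

Variables (QE : E -> probability (paths E) R) (QF : F -> probability (paths F) R).
Variable QG : G -> probability (paths G) R.
Hypotheses (sE : gaussian_shift_experiment QE) (sF : gaussian_shift_experiment QF).
Hypothesis sG : gaussian_shift_experiment QG.

(** By Tonelli the coordinates are integrated one after the other; orthogonality kills the cross
    terms, so the exponents add up to the expression for [L2comb s + L2comb t]. *)
Let product_mgf (h : E) s t c :
  (\int[(QF (k h) \x QG (p h))%E]_y (expR (lincomb y.1 s + lincomb y.2 t + c))%:E =
   (expR (inner (val h) (L2comb s + L2comb t) +
     inner (L2comb s + L2comb t) (L2comb s + L2comb t) / 2 + c))%:E)%E.
Proof.
rewrite fubini_tonelli1; last 2 first.
- by apply/measurable_EFinP/measurableT_comp => //; exact: m_affine.
- by move=> y; rewrite lee_fin expR_ge0.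
rewrite /fubini_F /=.
under eq_integral do under eq_integral do
  rewrite -addrA (addrC (lincomb _ s)) -(addrA (lincomb _ t)).
under eq_integral do rewrite gaussian_shift_mgf_affine// (addrC c) addrCA.
rewrite gaussian_shift_mgf_affine//; congr (expR _)%:E.
rewrite val_kp !innerE !(orthF, orthG) (innerC (L2comb t) (L2comb s)) orthFG.
by field.
Qed.

Let restrict (x : paths E) : paths F * paths G :=
  (fun f => x (inclusion FE f), fun g => x (inclusion GE g)).
Let glue (y : paths F * paths G) : paths E := fun h => y.1 (k h) + y.2 (p h).

Let m_restrict : measurable_fun setT restrict.
Proof.
by apply: measurable_fun_pair; apply: measurable_to_paths => g; exact: measurable_eval.
Qed.

Let m_glue : measurable_fun setT glue.
Proof.
apply: measurable_to_paths => h; apply: measurable_funD.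
- by apply: (measurableT_comp (measurable_eval (k h))); exact: measurable_fst.
- by apply: (measurableT_comp (measurable_eval (p h))); exact: measurable_snd.
Qed.

Let L2comb_inclusionF (s : seq (R * F)) :
  L2comb [seq (q.1, inclusion FE q.2) | q <- s] = L2comb s.
Proof. by rewrite /L2comb big_map. Qed.

Let L2comb_inclusionG (s : seq (R * G)) :
  L2comb [seq (q.1, inclusion GE q.2) | q <- s] = L2comb s.
Proof. by rewrite /L2comb big_map. Qed.

Let L2comb_cat (s t : seq (R * E)) : L2comb (s ++ t) = L2comb s + L2comb t.
Proof. exact: big_cat. Qed.

Let L2comb_split (s : seq (R * E)) :
  L2comb s = L2comb [seq (q.1, k q.2) | q <- s] + L2comb [seq (q.1, p q.2) | q <- s].
Proof.
rewrite /L2comb !big_map -big_split; apply: eq_bigr => q _ /=.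
by rewrite val_kp scalerDr.
Qed.

Let affine_prod : set (paths F * paths G -> R) :=
  [set f | exists s t c, f = fun y => lincomb y.1 s + lincomb y.2 t + c].

Let affine_paths : set (paths E -> R) :=
  [set f | exists s c, f = fun x => lincomb x s + c].

(** A combination of restricted coordinates is a combination of coordinates on [E], indexed by the
    concatenated list, so both laws have the transform of [product_mgf]. *)
Let restrict_law (h : E) (A : set (paths F * paths G)) : measurable A ->
  QE h (restrict @^-1` A) = (QF (k h) \x QG (p h))%E A.
Proof.
have mg : restrict \in mfun := mem_set m_restrict.
have mgf f : affine_prod f ->
    (\int[pushforward (QE h) (mfun_Sub mg)]_y (expR (f y))%:E =
     \int[(QF (k h) \x QG (p h))%E]_y (expR (f y))%:E)%E /\
    (\int[(QF (k h) \x QG (p h))%E]_y (expR (f y))%:E < +oo)%E.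
  move=> [s [t [c ->]]]; rewrite product_mgf; split; last exact: ltry.
  rewrite ge0_integral_pushforward//; last first.
    by apply/measurable_EFinP/measurableT_comp => //; exact: m_affine.
  rewrite -L2comb_inclusionF -L2comb_inclusionG -L2comb_cat.
  rewrite -(gaussian_shift_mgf_affine sE).
  by apply: eq_integral => x _; rewrite /= lincomb_cat !lincomb_map.
apply: (@laplace_determines _ _ _ (pushforward (QE h) (mfun_Sub mg)) _ affine_prod).
- move=> c; exists [::], [::], c; apply/funext => y.
  by rewrite /lincomb !big_nil !add0r.
- move=> _ _ [s [t [c ->]]] [s' [t' [c' ->]]]; exists (s ++ s'), (t ++ t'), (c + c').
  by apply/funext => y; rewrite !lincomb_cat; ring.
- move=> a _ [s [t [c ->]]].
  exists [seq (a * q.1, q.2) | q <- s], [seq (a * q.1, q.2) | q <- t], (a * c).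
  by apply/funext => y; rewrite !lincomb_scale; ring.
- by move=> _ [s [t [c ->]]]; exact: m_affine.
- by move=> f /mgf[-> ?].
- by move=> f /mgf[-> _].
- move=> S sS Sf; apply: smallest_sub => // _ [] [B mB <-]; rewrite setTI.
  + apply: (sigma_algebra_paths sS) mB => g D mD; apply: Sf mD.
    exists [:: (1, g)], [::], 0; apply/funext => y.
    by rewrite /lincomb big_nil big_seq1 mul1r !addr0.
  + apply: (sigma_algebra_paths sS) mB => g D mD; apply: Sf mD.
    exists [::], [:: (1, g)], 0; apply/funext => y.
    by rewrite /lincomb big_nil big_seq1 mul1r add0r addr0.
Qed.

(** Composed with [glue], a combination on [E] splits into one over the components [k] and one over
    the components [p], and [L2comb_split] matches the exponents. *)
Let glue_law (h : E) (A : set (paths E)) : measurable A ->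
  (QF (k h) \x QG (p h))%E (glue @^-1` A) = QE h A.
Proof.
have mg : glue \in mfun := mem_set m_glue.
have mgf f : affine_paths f ->
    (\int[pushforward (QF (k h) \x QG (p h))%E (mfun_Sub mg)]_y (expR (f y))%:E =
     \int[QE h]_y (expR (f y))%:E)%E /\ (\int[QE h]_y (expR (f y))%:E < +oo)%E.
  move=> [s [c ->]]; rewrite gaussian_shift_mgf_affine//; split; last exact: ltry.
  rewrite ge0_integral_pushforward//; last first.
    apply/measurable_EFinP/measurableT_comp => //.
    by apply: measurable_funD => //; exact: measurable_lincomb_path.
  rewrite L2comb_split -product_mgf//.
  by apply: eq_integral => y _; rewrite /= !lincomb_map -lincombD.
apply: (@laplace_determines _ _ _ (pushforward _ (mfun_Sub mg)) _ affine_paths).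
- by move=> c; exists [::], c; apply/funext => y; rewrite /lincomb big_nil add0r.
- move=> _ _ [s [c ->]] [s' [c' ->]]; exists (s ++ s'), (c + c').
  by apply/funext => y; rewrite !lincomb_cat; ring.
- move=> a _ [s [c ->]]; exists [seq (a * q.1, q.2) | q <- s], (a * c).
  by apply/funext => y; rewrite !lincomb_scale; ring.
- move=> _ [s [c ->]]; apply: measurable_funD => //.
  exact: measurable_lincomb_path.
- by move=> f /mgf[-> ?].
- by move=> f /mgf[-> _].
- move=> S sS Sf B mB; apply: (@sigma_algebra_paths E _ id _ sS) mB => g D mD.
  apply: Sf mD; exists [:: (1, g)], 0; apply/funext => y.
  by rewrite /lincomb big_seq1 mul1r addr0.
Qed.

Lemma gaussian_shift_product : independent_product FE GE QE QF QG.
Proof. by exists k, p; split. Qed.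

End GaussianShiftProduct.

(** * Decomposition of the target and of the experiment along the core *)

Theorem proposition8 (d : measure_display) (X : measurableType d) (R : realType)
    (PP : set (probability X R)) (P : probability X R) (PP_P : PP P)
    (T : set (L2 P)) (T_mean0 : T `<=` @L2_0 d X R P) (T_lin : linear_subspace T)
    (Psi : probability X R -> R) (gamma : L2 P -> R)
    (gamma_derivative : directional_derivative PP T Psi gamma)
    (assumption1 : path_realization PP T)
    (assumption2 : core T gamma = additivity_space T gamma) :
  let Hk := core T gamma in
  let Hp := orthocomplement Hk `&` T in
  exists psi : L2 P, riesz_representer Hk gamma psi /\
    [/\ forall h hk hp : L2 P, T h -> Hk hk -> Hp hp -> h = hk + hp ->
          gamma h = inner psi hk + gamma hp,
        forall (QT : T -> probability (paths T) R)
               (Qk : Hk -> probability (paths Hk) R)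
               (Qp : Hp -> probability (paths Hp) R),
          gaussian_shift_experiment QT ->
          gaussian_shift_experiment Qk ->
          gaussian_shift_experiment Qp ->
          independent_product (@core_sub d X R P T gamma)
            (@subIsetr _ (orthocomplement Hk) T) QT Qk Qp,
        information_bound Hk gamma = ((L2norm psi) ^+ 2)%:E
      & core Hp gamma = [set 0]].
Proof.
have [gamma_hom _] := gamma_derivative; have [T_closed _] := assumption1.
have gamma_cont := directional_derivative_continuous gamma_derivative assumption1.
have HkE := assumption2.
have Hk_lin := additivity_linear_subspace T_lin gamma_hom.
have Hk_closed := additivity_closed T_lin T_closed gamma_cont.
have [psi psiP] := additivity_representer T_lin gamma_hom T_closed gamma_cont.
(* The facts on the additivity space are transferred to the core through [assumption2]. *)
move=> Hk Hp; rewrite -HkE -/Hk in Hk_lin Hk_closed psiP.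
have HkT w : Hk w -> T w by exact: core_sub.
exists psi; split => //; split.
- move=> h hk hp _ Hkhk [_ Thp] ->.
  have : additivity_space T gamma hk by rewrite -HkE.
  by case=> _ gk; rewrite addrC gk// addrC psiP.2.
- move=> QT Qk Qp sT sk sp.
  have orth (f : Hk) (g : Hp) : inner (val f) (val g) = 0.
    by rewrite innerC; have [/= /(_ _ (set_mem (valP f)))] := set_mem (valP g).
  have decomp (h : T) : exists fg : Hk * Hp, val h = val fg.1 + val fg.2.
    have [v Hkv ov] := orthogonal_projection (val h) Hk_lin Hk_closed.
    have Hpv : Hp (val h - v).
      split => //; apply: linear_subspaceB => //; last exact: HkT.
      exact: (set_mem (valP h)).
    exists (exist _ v (mem_set Hkv), exist _ (val h - v) (mem_set Hpv)) => /=.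
    by rewrite addrC subrK.
  have [kp hkp] := choice decomp.
  apply: (@gaussian_shift_product _ _ _ _ _ _ _ _ _ (fst \o kp) (snd \o kp)) => // h f g.
  split=> [hfg|[-> ->]]; last exact: hkp.
  (* Uniqueness of the components: the difference of two [Hk] parts equals a difference of two [Hp]
     parts, so it is orthogonal to itself and vanishes. *)
  have Hkd : Hk (val f - val (kp h).1).
    by apply: linear_subspaceB => //; exact: (set_mem (valP _)).
  have e : val f - val (kp h).1 = val (kp h).2 - val g.
    by apply/eqP; rewrite subr_eq addrAC -subr_eq opprK addrC -hfg addrC hkp addrC.
  have fk : val f = val (kp h).1.
    apply/eqP; rewrite -subr_eq0; apply/eqP/inner_eq0; rewrite {1}e.
    have HpE (g' : Hp) : inner (val g') (val f - val (kp h).1) = 0.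
      by have [/= /(_ _ Hkd)] := set_mem (valP g').
    by rewrite innerDl innerNl !HpE subrr.
  split; apply: val_inj => //=.
  by apply/eqP; rewrite eq_sym -subr_eq0 -e fk subrr.
- exact: information_bound_representer.
- by rewrite /Hp /Hk HkE; apply: core_orthocomplement.
Qed.
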